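(* Let $K$ be a field, $G$ a finite group with $\mathrm{char}\,K\nmid|G|$, $A$ a finite-dimensional $G$-graded $K$-algebra with Jacobson radical $J$, and $M$ a finitely generated graded $A$-module. Then $M\otimes_K KG^*$ is a quasi-Koszul $A\# G^*$-module if and only if $M$ is a quasi-Koszul $A$-module. In particular, $A\# G^*$ is quasi-Koszul if and only if $A$ is quasi-Koszul. Moreover, $$\mathrm{Ext}^*_{A\# G^*}\big((A\# G^* )/J(A\# G^* ),\,(A\# G^* )/J(A\# G^* )\big)\;\cong\;\mathrm{Ext}^*_A(A/J,A/J)\# G^*$$ as positively graded $K$-algebras, where $J(A\# G^* )$ is the Jacobson radical of $A\# G^*$.
   Context: Modules are left modules. For a $G$-graded algebra $A=\coprod_{g\in G}A_g$, a graded $A$-module is an $A$-module $M=\coprod_{g\in G}M_g$ with $A_gM_h\subseteq M_{gh}$; a subscript $g$ on an element denotes its degree-$g$ component. $KG^*$ is the dual algebra of $KG$ with dual basis $\{p_g\mid g\in G\}$, so $p_gp_h=\delta_{gh}p_h$. The smash product $A\# G^*$ is the $K$-vector space $A\otimes_K KG^*$ (write $a\# p_g$ for $a\otimes p_g$) with multiplication $(a\# p_g)(b\# p_h)=ab_{gh^{-1}}\# p_h$. For a graded $A$-module $M$, $M\otimes_KKG^*$ is a left $A\# G^*$-module via $(a\otimes p_g)(m\otimes p_h)=am_{gh^{-1}}\otimes p_h$. Products of elements of extension groups are Yoneda products, written from left to right: $[\xi]\in \mathrm{Ext}^r_B(X,Y)$ and $[\zeta]\in\mathrm{Ext}^l_B(Y,Z)$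 have product $[\xi][\zeta]\in\mathrm{Ext}^{r+l}_B(X,Z)$ (with $\mathrm{Ext}^0=\mathrm{Hom}$). A product of subspaces means the $K$-span of all products of elements. $\mathrm{Ext}^*_B(X,X)=\coprod_{i\ge0}\mathrm{Ext}^i_B(X,X)$ is the Yoneda algebra. A graded $K$-algebra $E=\coprod_{i\ge 0}E_i$ is generated in degree 0 and 1 if $E_i=E_1^i$ for all $i\ge2$. A noetherian semiperfect $K$-algebra $B$ is quasi-Koszul if $\mathrm{Ext}^*_B(B/J(B),B/J(B))$ is generated in degree 0 and 1. A $B$-module $X$ is quasi-Koszul if $\mathrm{Ext}^i_B(X,B/J(B))\,\mathrm{Ext}^1_B(B/J(B),B/J(B))=\mathrm{Ext}^{i+1}_B(X,B/J(B))$ for all $i\ge0$. $G$-grading on Ext: for graded $A$-modules $X,Y$ one has, since $G$ is finite, $\mathrm{Hom}_A(X,Y)=\bigoplus_{g\in G}\mathrm{Hom}_A(X,Y)_g$ with $\mathrm{Hom}_A(X,Y)_g=\{f\in\mathrm{Hom}_A(X,Y)\mid f(X_h)\subseteq Y_{hg}\text{ for all }h\in G\}$. Computing $\mathrm{Ext}^i_A(X,Y)$ from a graded projective resolution of $X$ gives an induced $G$-grading on $\mathrm{Ext}^i_A(X,Y)$. Since $\mathrm{char}\,K\nmid|G|$, $J$ equals the graded Jacobson radical of $A$, so $A/J$ is a graded $A$-module, and $\mathrm{Ext}^*_A(A/J,A/J)$ becomes a $G$-graded algebra; $\mathrm{Ext}^*_A(A/J,A/J)\# G^*$ is its smash product,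 graded with $\mathrm{Ext}^i_A(A/J,A/J)\otimes_KKG^*$ in degree $i$. *)

(* Defs.v *)
From HB Require Import structures.
From mathcomp Require Import all_boot all_order all_fingroup all_algebra all_field.
From Stdlib Require Import ClassicalEpsilon.

Set Implicit Arguments.
Unset Strict Implicit.
Unset Printing Implicit Defensive.

Import GRing.Theory.
Local Open Scope ring_scope.

Section LinearAlgebra.
Variables (K : fieldType) (V : vectType K).

(* The {vspace V} with the same elements as P; meaningful when P is a linear
   subspace, see vspace_ofP. *)
Definition vspace_of (P : V -> Prop) : {vspace V} :=
  epsilon (inhabits 0%VS) (fun U : {vspace V} => forall v, v \in U <-> P v).

Lemma vspace_ofP (P : V -> Prop) :
  P 0 -> (forall k u v, P u -> P v -> P (k *: u + v)) ->
  forall v, v \in vspace_of P <-> P v.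
Proof.
move=> P0 PL; rewrite /vspace_of; 
pose Q (U : {vspace V}) := forall v, v \in U <-> P v.
suff [U QU] : exists U, Q U by exact: (epsilon_spec (inhabits 0%VS) Q (ex_intro _ U QU)).
suff ext n : forall U : {vspace V}, (forall v, v \in U -> P v) ->
    (\dim (fullv : {vspace V}) - \dim U <= n)%N ->
    exists U : {vspace V}, forall v, v \in U <-> P v.
  by apply: (ext _ 0%VS _ (leqnn _)) => v; rewrite memv0 => /eqP->.
elim: n => [|n IHn] U UP leUn.
  exists U => v; split; first exact: UP.
  move=> _; have /eqP -> : U == fullv; last exact: memvf.
  by rewrite eqEdim subvf -subn_eq0 -leqn0.
have [[v [Pv vU]] | noP] := excluded_middle_informative (exists v, P v /\ v \notin U).
  apply: (IHn (U + <[v]>)%VS).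
    move=> _ /memv_addP[u uU [_ /vlineP[k ->] ->]].
    by rewrite addrC; apply: PL => //; apply: UP.
  have ltU : (\dim U < \dim (U + <[v]>))%N.
    rewrite (ltn_leqif (dimv_leqif_eq (addvSl _ _))).
    apply: contra vU => /eqP eqU; rewrite {}[U]eqU.
    exact: (subvP (addvSr _ _)) (memv_line v).
  rewrite -ltnS; apply: leq_trans leUn; rewrite ltn_sub2l //.
  by apply: leq_trans ltU _; rewrite dimvS ?subvf.
exists U => v; split; first exact: UP.
by move=> Pv; apply/negPn/negP => vU; apply: noP; exists v.
Qed.

(* The quotient U / W (for W <= U) is carried by a complement of W in U. *)
Definition quotv (U W : {vspace V}) : vectType K := subvs_of (U :\: W)%VS.

Definition quotv_pi (U W : {vspace V}) : 'Hom(V, quotv U W) :=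
  (linfun (vsproj (U :\: W)%VS) \o addv_pi1 U W)%VF.

Definition quotv_repr (U W : {vspace V}) : 'Hom(quotv U W, V) := linfun vsval.

Lemma quotv_repr_mem U W (x : quotv U W) : quotv_repr U W x \in U.
Proof. by rewrite lfunE; apply: (subvP (diffvSl U W)); apply: subvsP. Qed.

Lemma quotv_piE U W v : quotv_repr U W (quotv_pi U W v) = addv_pi1 U W v.
Proof.
rewrite [LHS]lfunE /= /quotv_pi comp_lfunE.
rewrite (lfunE (vsproj (U :\: W)%VS)) /=.
by apply: vsprojK; apply: memv_pi.
Qed.

Lemma quotv_reprK U W : cancel (quotv_repr U W) (quotv_pi U W).
Proof.
move=> x; rewrite (lfunE vsval) /quotv_pi comp_lfunE.
rewrite (lfunE (vsproj (U :\: W)%VS)) /= daddv_pi_id ?vsvalK //.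
- exact: capv_diff.
- exact: subvsP.
Qed.

Lemma quotv_pi_eq0 U W v :
  (W <= U)%VS -> v \in U -> (quotv_pi U W v == 0) = (v \in W).
Proof.
move=> sWU vU; have eqv : addv_pi1 U W v + addv_pi2 U W v = v.
  by apply: addv_pi1_pi2; apply: (subvP (addvSl U W)).
apply/eqP/idP => [piv0 | vW].
  rewrite -eqv -quotv_piE piv0 linear0 add0r.
  exact: memv_pi2.
rewrite /quotv_pi comp_lfunE.
suff -> : addv_pi1 U W v = 0 by rewrite linear0.
by apply: (addIr v); rewrite add0r -{2}(addv_pi2_id U vW).
Qed.

Definition is_grading (I : finType) (Vg : I -> {vspace V}) : Prop :=
  directv (\sum_i Vg i)%VS /\ (\sum_i Vg i)%VS = fullv.

(* The component v_i in Vg i of v; meaningful when is_grading Vg holds. *)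
Definition hcomp (I : finType) (Vg : I -> {vspace V}) (i : I) : 'End(V) :=
  sumv_pi (\sum_j Vg j)%VS i.

Lemma hcomp_mem (I : finType) (Vg : I -> {vspace V}) i v : hcomp Vg i v \in Vg i.
Proof. exact: memv_sum_pi. Qed.

Lemma hcomp_sum (I : finType) (Vg : I -> {vspace V}) v :
  is_grading Vg -> \sum_i hcomp Vg i v = v.
Proof. by case=> _ full; apply: sumv_pi_sum; rewrite full memvf. Qed.

Lemma hcomp_uniq (I : finType) (Vg : I -> {vspace V}) (u : I -> V) i :
  is_grading Vg -> (forall j, u j \in Vg j) -> hcomp Vg i (\sum_j u j) = u i.
Proof.
move=> grV uV; case: (grV) => /directv_sum_unique/= dirV _; apply/eqP.
have /= := dirV (fun j => hcomp Vg j (\sum_j u j)) u.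
rewrite hcomp_sum // eqxx => /(_ _ _)/esym/forall_inP/= eqs; apply: eqs => //.
by move=> j _; apply: hcomp_mem.
Qed.

End LinearAlgebra.

(* A finitely generated left module over the finite-dimensional algebra B is a
   finite-dimensional K-space with an action of B;
   see fmod_of_finitely_generated. *)
Record fmod (K : fieldType) (B : falgType K) := Fmod {
  fmod_car :> vectType K;
  act : B -> 'End(fmod_car);
  act_linear : linear act;
  act_1 : act 1 = \1%VF;
  act_mul : forall a b, act (a * b) = (act a \o act b)%VF }.

Arguments act {K B f} b.

Section Modules.
Variables (K : fieldType) (B : falgType K).
Implicit Types X Y Z P : fmod B.

Definition is_hom X Y (f : 'Hom(X, Y)) : Prop :=
  forall b x, f (act b x) = act b (f x).

Lemma is_hom_linear (X Y : fmod B) k (f g : 'Hom(X, Y)) :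
  is_hom f -> is_hom g -> is_hom (k *: f + g).
Proof.
by move=> hf hg b x; rewrite !add_lfunE !scale_lfunE hf hg linearP.
Qed.

Lemma is_hom0 (X Y : fmod B) : is_hom (0 : 'Hom(X, Y)).
Proof. by move=> b x; rewrite !zero_lfunE linear0. Qed.

Lemma is_hom_comp (X Y Z : fmod B) (g : 'Hom(Y, Z)) (f : 'Hom(X, Y)) :
  is_hom g -> is_hom f -> is_hom (g \o f)%VF.
Proof. by move=> hg hf b x; rewrite !comp_lfunE hf hg. Qed.

Lemma act0 X : act (0 : B) = 0 :> 'End(X).
Proof.
by have := act_linear X (-1) 0 0; rewrite scaler0 addr0 scaleN1r addNr.
Qed.

Definition projective P : Prop :=
  forall Y Z (p : 'Hom(Y, Z)) (f : 'Hom(P, Z)),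
    is_hom p -> limg p = fullv -> is_hom f ->
    exists2 g : 'Hom(P, Y), is_hom g & (p \o g)%VF = f.

Definition submodule X (U : {vspace X}) : Prop :=
  forall b x, x \in U -> act b x \in U.

Section Quotient.
Variables (X : fmod B) (U : {vspace X}) (smU : submodule U).

Definition quot_act (b : B) : 'End(quotv fullv U) :=
  (quotv_pi fullv U \o act b \o quotv_repr fullv U)%VF.

Lemma quot_piE x y :
  x - y \in U -> quotv_pi fullv U x = quotv_pi fullv U y.
Proof.
by move=> xyU; apply/eqP; rewrite -subr_eq0 -linearB quotv_pi_eq0 ?subvf ?memvf.
Qed.

Lemma quot_repr_pi x : quotv_repr fullv U (quotv_pi fullv U x) - x \in U.
Proof.
rewrite -(@quotv_pi_eq0 _ _ fullv) ?subvf ?memvf // linearB /=.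
by rewrite quotv_reprK subrr.
Qed.

Lemma quot_act_pi b x :
  quot_act b (quotv_pi fullv U x) = quotv_pi fullv U (act b x).
Proof.
rewrite /quot_act 2!comp_lfunE; apply: quot_piE.
by rewrite -linearB; apply: smU; apply: quot_repr_pi.
Qed.

Lemma quot_act_linear : linear quot_act.
Proof.
move=> k a b; apply/lfunP => x; rewrite -(quotv_reprK x).
rewrite add_lfunE scale_lfunE !quot_act_pi act_linear.
by rewrite add_lfunE scale_lfunE linearP.
Qed.

Lemma quot_act_1 : quot_act 1 = \1%VF.
Proof.
by apply/lfunP => x; rewrite -(quotv_reprK x) quot_act_pi act_1 !id_lfunE.
Qed.

Lemma quot_act_mul a b : quot_act (a * b) = (quot_act a \o quot_act b)%VF.
Proof.
apply/lfunP => x; rewrite -(quotv_reprK x) comp_lfunE !quot_act_pi act_mul.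
by rewrite comp_lfunE.
Qed.

Definition quot_mod : fmod B := Fmod quot_act_linear quot_act_1 quot_act_mul.

End Quotient.

Lemma amull_linear : linear (@amull K B).
Proof.
by move=> k a b; apply/lfunP => x; rewrite add_lfunE scale_lfunE !lfunE /= mulrDl scalerAl.
Qed.

Lemma amull_mul (a b : B) : amull (a * b) = (amull a \o amull b)%VF.
Proof. by apply/lfunP => x; rewrite comp_lfunE !lfunE /= mulrA. Qed.

Definition regular_mod : fmod B := Fmod amull_linear (amull1 B) amull_mul.

(* A left ideal of B is a K-subspace, as (k%:A) * x = k *: x; the left ideals are
   therefore the submodules of the regular module. *)
Definition maximal_left_ideal (I : {vspace B}) : Prop :=
  [/\ submodule (I : {vspace regular_mod}), I != fullv &
      forall L : {vspace B}, submodule (L : {vspace regular_mod}) ->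
        (I <= L)%VS -> L = I \/ L = fullv].

Definition jacobson : {vspace B} :=
  vspace_of (fun x => forall I, maximal_left_ideal I -> x \in I).

Lemma jacobsonP x :
  x \in jacobson <-> (forall I, maximal_left_ideal I -> x \in I).
Proof.
apply: vspace_ofP => [I _ | k u v uI vI I maxI]; first exact: mem0v.
by rewrite memvD ?memvZ ?uI ?vI.
Qed.

Lemma jacobson_submodule : submodule (jacobson : {vspace regular_mod}).
Proof.
move=> b x /jacobsonP xJ; apply/jacobsonP => I maxI.
by case: (maxI) => smI _ _; apply: smI; apply: xJ.
Qed.

(* B / J(B) *)
Definition top_mod : fmod B := quot_mod jacobson_submodule.

(* Projective resolution
   ... -> res_mod 2 -> res_mod 1 -> res_mod 0 -> X -> 0. *)
Record resolution (X : fmod B) := Resolution {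
  res_mod :> nat -> fmod B;
  res_d : forall n, 'Hom(res_mod n.+1, res_mod n);
  res_aug : 'Hom(res_mod 0, X);
  res_projective : forall n, projective (res_mod n);
  res_d_hom : forall n, is_hom (res_d n);
  res_aug_hom : is_hom res_aug;
  res_exact : forall n, limg (res_d n.+1) = lker (res_d n);
  res_exact0 : limg (res_d 0) = lker res_aug;
  res_aug_surj : limg res_aug = fullv }.

End Modules.

Section Ext.
Variables (K : fieldType) (B : falgType K).

(* Ext^i_B(X, Y), computed from the projective resolution P of X: classes of
   B-linear maps P i -> Y vanishing on the image of P i.+1, modulo those that
   factor through the differential of P leaving P i. *)
Section Groups.
Variables (X : fmod B) (P : resolution X) (Y : fmod B).

Definition cocycles i : {vspace 'Hom(P i, Y)} :=
  vspace_of (fun f => is_hom f /\ (f \o res_d P i)%VF = 0).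

Definition coboundaries i : {vspace 'Hom(P i, Y)} :=
  match i with
  | 0 => 0%VS
  | j.+1 => vspace_of (fun f =>
      exists2 g : 'Hom(P j, Y), is_hom g & f = (g \o res_d P j)%VF)
  end.

Definition Ext i : vectType K := quotv (cocycles i) (coboundaries i).

Definition ext_class i (f : 'Hom(P i, Y)) : Ext i := quotv_pi _ _ f.
Definition ext_repr i (x : Ext i) : 'Hom(P i, Y) := quotv_repr _ _ x.

Lemma cocyclesP i f :
  f \in cocycles i <-> is_hom f /\ (f \o res_d P i)%VF = 0.
Proof.
apply: vspace_ofP => [|k u v [hu u0] [hv v0]].
  by split; [apply: is_hom0 | rewrite comp_lfun0l].
by split; [apply: is_hom_linear | rewrite comp_lfunDl -comp_lfunZl u0 v0 scaler0 addr0].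
Qed.

Lemma coboundariesP j (f : 'Hom(P j.+1, Y)) :
  f \in coboundaries j.+1 <->
  exists2 g : 'Hom(P j, Y), is_hom g & f = (g \o res_d P j)%VF.
Proof.
apply: (vspace_ofP (P := fun f => exists2 g : 'Hom(P j, Y),
  is_hom g & f = (g \o res_d P j)%VF)) => [|k _ _ [u hu ->] [v hv ->]].
  by exists 0; [apply: is_hom0 | rewrite comp_lfun0l].
by exists (k *: u + v); [apply: is_hom_linear | rewrite comp_lfunDl -comp_lfunZl].
Qed.

Lemma coboundaries_sub i : (coboundaries i <= cocycles i)%VS.
Proof.
case: i => [|j]; first exact: sub0v.
apply/subvP => f /coboundariesP[g hg ->]; apply/cocyclesP; split.
  by apply: is_hom_comp => //; apply: res_d_hom.
apply/lfunP => x; rewrite !comp_lfunE zero_lfunE.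
suff /eqP -> : res_d P j (res_d P j.+1 x) == 0 by rewrite linear0.
by rewrite -memv_ker -res_exact memv_img ?memvf.
Qed.

End Groups.

(* F lifts the cocycle f : P r -> Y to a chain map P (n + r) -> Q n. *)
Definition is_lift (X Y : fmod B) (P : resolution X) (Q : resolution Y) r
    (f : 'Hom(P r, Y)) (F : forall n, 'Hom(P (n + r)%N, Q n)) : Prop :=
  [/\ forall n, is_hom (F n),
      (res_aug Q \o F 0%N)%VF = f &
      forall n, (res_d Q n \o F n.+1)%VF = (F n \o res_d P (n + r)%N)%VF].

(* The comparison theorem provides a lift of every cocycle; the class of the
   product below does not depend on the lift chosen. *)
Definition lift (X Y : fmod B) (P : resolution X) (Q : resolution Y) r
    (f : 'Hom(P r, Y)) : forall n, 'Hom(P (n + r)%N, Q n) :=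
  epsilon (inhabits (fun n => 0)) (is_lift f).

(* The product [x][y], written from left to right, of x in Ext^r(X, Y) and y in
   Ext^l(Y, Z), in Ext^(l + r)(X, Z): y composed after a lift of x. No sign is
   introduced in the lift or in the composition. *)
Definition yoneda (X Y Z : fmod B) (P : resolution X) (Q : resolution Y) r l
    (x : Ext P Y r) (y : Ext Q Z l) : Ext P Z (l + r)%N :=
  ext_class (ext_repr y \o lift Q (ext_repr x) l)%VF.

End Ext.

(* Span of all products m x y with x in U and y in W *)
Definition prod_span (K : fieldType) (E1 E2 E3 : vectType K)
    (m : E1 -> E2 -> E3) (U : {vspace E1}) (W : {vspace E2}) : {vspace E3} :=
  vspace_of (fun z => forall T : {vspace E3},
    (forall x y, x \in U -> y \in W -> m x y \in T) -> z \in T).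

Lemma prod_spanP (K : fieldType) (E1 E2 E3 : vectType K)
    (m : E1 -> E2 -> E3) (U : {vspace E1}) (W : {vspace E2}) z :
  z \in prod_span m U W <->
  (forall T : {vspace E3},
    (forall x y, x \in U -> y \in W -> m x y \in T) -> z \in T).
Proof.
apply: vspace_ofP => [T _ | k u v uT vT T mT]; first exact: mem0v.
by rewrite memvD ?memvZ ?uT ?vT.
Qed.

(* The components, unit and multiplication of a positively graded K-algebra. The product of
   degrees i and j is put in degree j + i, not i + j, because 1 + i reduces
   to i.+1. *)
Record posgr (K : fieldType) := Posgr {
  posgr_deg :> nat -> vectType K;
  posgr_one : posgr_deg 0;
  posgr_mul : forall i j, posgr_deg i -> posgr_deg j -> posgr_deg (j + i)%N }.

Definition posgr_iso (K : fieldType) (E F : posgr K) : Prop :=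
  exists phi : forall i, 'Hom(E i, F i),
    [/\ forall i, bijective (phi i),
        phi 0%N (posgr_one E) = posgr_one F &
        forall i j (x : E i) (y : E j),
          phi (j + i)%N (posgr_mul x y) = posgr_mul (phi i x) (phi j y)].

(* E_1^(i+1), as a subspace of E_(i+1). *)
Fixpoint deg1_pow (K : fieldType) (E : posgr K) (i : nat) : {vspace E i.+1} :=
  match i with
  | 0 => fullv
  | j.+1 => prod_span (@posgr_mul K E j.+1 1) (deg1_pow E j) fullv
  end.

(* E_(i+2) = E_1^(i+2) for all i >= 0. *)
Definition generated01 (K : fieldType) (E : posgr K) : Prop :=
  forall i, deg1_pow E i.+1 = fullv.

Section QuasiKoszul.
Variables (K : fieldType) (B : falgType K).

(* The Yoneda algebra Ext^*_B(X, X) *)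
Definition ext_alg (X : fmod B) (P : resolution X) : posgr K :=
  Posgr (ext_class (res_aug P) : Ext P X 0)
        (fun i j (x : Ext P X i) (y : Ext P X j) => yoneda x y).

Definition quasi_koszul_mod (X : fmod B) : Prop :=
  forall (P : resolution X) (Q : resolution (top_mod B)) (i : nat),
    prod_span (fun (x : Ext P (top_mod B) i) (y : Ext Q (top_mod B) 1) =>
                 yoneda x y : Ext P (top_mod B) i.+1) fullv fullv = fullv.

Definition quasi_koszul_alg : Prop :=
  forall P : resolution (top_mod B), generated01 (ext_alg P).

End QuasiKoszul.

Record galg (K : fieldType) (gT : finGroupType) (A : falgType K) := Galg {
  galg_deg :> gT -> {vspace A};
  galg_grading : is_grading galg_deg;
  galg_mul : forall g h a b,
    a \in galg_deg g -> b \in galg_deg h -> a * b \in galg_deg (g * h)%g }.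

Section Smash.
Variables (K : fieldType) (gT : finGroupType) (A : falgType K).
Variable gA : galg gT A.

Definition graded_module (X : fmod A) (gX : gT -> {vspace X}) : Prop :=
  is_grading gX /\
  forall g h a x, a \in gA g -> x \in gX h -> act a x \in gX (g * h)%g.

Record gmod := Gmod {
  gmod_mod :> fmod A;
  gmod_deg : gT -> {vspace gmod_mod};
  gmod_graded : graded_module gmod_deg }.

Lemma act_suml (X : fmod A) (I : finType) (b : I -> A) (x : X) :
  act (\sum_i b i) x = \sum_i act (b i) x.
Proof.
have linx : linear (fun c : A => act c x).
  by move=> k c d; rewrite act_linear add_lfunE scale_lfunE.
pose lx := HB.pack_for {linear A -> X} (fun c : A => act c x)
  (GRing.isLinear.Build K A X _ _ linx).
exact: (raddf_sum lx).
Qed.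

Lemma hcomp_act (X : fmod A) (gX : gT -> {vspace X}) (a : A) (x : X) g h :
  graded_module gX -> x \in gX h ->
  hcomp gX g (act a x) = act (hcomp gA (g * h^-1)%g a) x.
Proof.
move=> [grX actX] xh; have /(_ a) := hcomp_sum _ (galg_grading gA).
move=> {1}<-; set b := fun k => hcomp gA k a.
have -> : act (\sum_k b k) x = \sum_k act (b (k * h^-1)%g) x.
  rewrite [RHS](reindex_inj (mulIg h)) /=.
  rewrite (eq_bigr (fun k => act (b k) x)) => [|k _]; last by rewrite mulgK.
  exact: act_suml.
rewrite hcomp_uniq // => k.
by rewrite -{2}(mulgKV h k); apply: actX => //; apply: hcomp_mem.
Qed.

Lemma galg_regular : graded_module (gA : gT -> {vspace regular_mod A}).
Proof.
split=> [|g h a x ag xh]; first exact: galg_grading.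
by rewrite /= lfunE; apply: galg_mul.
Qed.

(* The component in degree g of a product whose right factor is homogeneous. *)
Lemma hcomp_mul (a b : A) g h :
  b \in gA h -> hcomp gA g (a * b) = hcomp gA (g * h^-1)%g a * b.
Proof.
by move=> bh; have := hcomp_act a g galg_regular bh; rewrite /= !lfunE.
Qed.

Lemma hcomp_id (a : A) g h : a \in gA h -> hcomp gA g a = a *+ (g == h).
Proof.
move=> ah; rewrite -{1}[a](_ : \sum_k (a *+ (k == h)) = a).
  rewrite hcomp_uniq; first by []; first exact: galg_grading.
  by move=> k; case: eqP => [->|_]; rewrite ?mulr1n ?mulr0n ?mem0v.
by rewrite (bigD1 h) //= eqxx big1 ?addr0 // => k /negPf->.
Qed.

Lemma galg_one : (1 : A) \in gA 1%g.
Proof.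
have e1 (a : A) : a * hcomp gA 1%g 1 = a.
  have hom g : hcomp gA g a * hcomp gA 1%g 1 = hcomp gA g a.
    have := hcomp_sum (1 : A) (galg_grading gA).
    move/(congr1 (fun x => hcomp gA g (hcomp gA g a * x))).
    rewrite mulr1 (hcomp_id _ (hcomp_mem gA g a)) eqxx mulr1n => {2}<-.
    rewrite mulr_sumr linear_sum /= (bigD1 1%g) //= big1 ?addr0 => [|k k1].
      have := galg_mul (hcomp_mem gA g a) (hcomp_mem gA 1%g 1).
      by rewrite mulg1 => /(hcomp_id g)->; rewrite eqxx.
    have /(hcomp_id g) -> := galg_mul (hcomp_mem gA g a) (hcomp_mem gA k 1).
    by rewrite -[X in X == _]mulg1 (inj_eq (mulgI g)) eq_sym (negPf k1).
  rewrite -{1 2}(hcomp_sum a (galg_grading gA)) mulr_suml.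
  by apply: eq_bigr => g _; apply: hom.
by rewrite -[1]e1 mul1r; apply: hcomp_mem.
Qed.

(* A # G^*: the function x stands for \sum_g x g # p_g. The multiplication depends
   on the grading, which is therefore a parameter of the type. *)
Definition smash_alg (D : galg gT A) : Type := {ffun gT -> A}.
Local Notation smash := (smash_alg gA).

HB.instance Definition _ := Vector.copy smash {ffun gT -> A}.

Definition smash_one : smash := [ffun=> 1].

Definition smash_mul (x y : smash) : smash :=
  [ffun h => \sum_g x g * hcomp gA (g * h^-1)%g (y h)].

Lemma smash_mulA : associative smash_mul.
Proof.
move=> x y z; apply/ffunP => h; rewrite !ffunE.
under eq_bigr => k _ do rewrite linear_sum mulr_sumr /=.
rewrite exchange_big; apply: eq_bigr => g _. rewrite ffunE mulr_suml.
apply: eq_bigr => k _; rewrite (hcomp_mul _ _ (hcomp_mem _ _ _)) mulrA.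
by rewrite invMg invgK mulgA mulgKV.
Qed.

Lemma smash_mul1 : left_id smash_one smash_mul.
Proof.
move=> x; apply/ffunP => h; rewrite ffunE.
under eq_bigr => g _ do rewrite ffunE mul1r.
by rewrite -[RHS](hcomp_sum _ (galg_grading gA)) [RHS](reindex_inj (mulIg (h^-1)%g)).
Qed.

Lemma smash_mulr1 : right_id smash_one smash_mul.
Proof.
move=> x; apply/ffunP => h; rewrite !ffunE (bigD1 h) //=.
rewrite (hcomp_id _ galg_one) mulgV eqxx mulr1 big1 ?addr0 // => g gh.
by rewrite (hcomp_id _ galg_one) -eq_mulgV1 (negPf gh) mulr0.
Qed.

Lemma smash_mulDl : left_distributive smash_mul +%R.
Proof.
move=> x y z; apply/ffunP => h; rewrite !ffunE -big_split.
by apply: eq_bigr => g _; rewrite ffunE mulrDl.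
Qed.

Lemma smash_mulDr : right_distributive smash_mul +%R.
Proof.
move=> x y z; apply/ffunP => h; rewrite !ffunE -big_split.
by apply: eq_bigr => g _; rewrite linearD mulrDr.
Qed.

Lemma smash_one_neq0 : smash_one != 0.
Proof. by apply/eqP => /ffunP/(_ 1%g)/eqP; rewrite !ffunE oner_eq0. Qed.

HB.instance Definition _ := GRing.Zmodule_isNzRing.Build smash
  smash_mulA smash_mul1 smash_mulr1 smash_mulDl smash_mulDr smash_one_neq0.

Lemma smash_scaleAl (k : K) (x y : smash) : k *: (x * y) = k *: x * y.
Proof.
apply/ffunP => h; rewrite !ffunE scaler_sumr.
by apply: eq_bigr => g _; rewrite ffunE scalerAl.
Qed.

HB.instance Definition _ := GRing.Lmodule_isLalgebra.Build K smash smash_scaleAl.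

Lemma smash_scaleAr (k : K) (x y : smash) : k *: (x * y) = x * (k *: y).
Proof.
apply/ffunP => h; rewrite !ffunE scaler_sumr.
by apply: eq_bigr => g _; rewrite linearZ scalerAr.
Qed.

HB.instance Definition _ :=
  GRing.LSemiAlgebra_isSemiAlgebra.Build K smash smash_scaleAr.
HB.instance Definition _ := Algebra_isFalgebra.Build K smash.

(* M (x) KG^*: the function v stands for \sum_h v h (x) p_h. *)
Section SmashModule.
Variable M : gmod.

Definition smash_act_fun (x : smash) (v : {ffun gT -> M}) : {ffun gT -> M} :=
  [ffun h => \sum_g act (x g) (hcomp (gmod_deg M) (g * h^-1)%g (v h))].

Lemma smash_act_fun_linear x : linear (smash_act_fun x).
Proof.
move=> k u v; apply/ffunP => h; rewrite !ffunE scaler_sumr -big_split.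
by apply: eq_bigr => g _; rewrite !linearP.
Qed.

HB.instance Definition _ x :=
  GRing.isLinear.Build K {ffun gT -> M} {ffun gT -> M} _ (smash_act_fun x)
    (smash_act_fun_linear x).

Definition smash_act (x : smash) : 'End({ffun gT -> M}) :=
  linfun (smash_act_fun x).

Lemma smash_act_linear : linear smash_act.
Proof.
move=> k x y; apply/lfunP => v; rewrite add_lfunE scale_lfunE !lfunE /=.
apply/ffunP => h; rewrite !ffunE scaler_sumr -big_split.
apply: eq_bigr => g _; rewrite !ffunE act_linear.
by rewrite add_lfunE scale_lfunE.
Qed.

Lemma smash_act_1 : smash_act 1 = \1%VF.
Proof.
apply/lfunP => v; rewrite lfunE id_lfunE /=; apply/ffunP => h; rewrite ffunE.
under eq_bigr => g _ do rewrite ffunE act_1 id_lfunE.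
have [grM _] := gmod_graded M.
by rewrite -[RHS](hcomp_sum _ grM) [RHS](reindex_inj (mulIg (h^-1)%g)).
Qed.

Lemma smash_act_mul x y : smash_act (x * y) = (smash_act x \o smash_act y)%VF.
Proof.
apply/lfunP => v; rewrite comp_lfunE !lfunE /=.
apply/ffunP => h; rewrite [LHS]ffunE [RHS]ffunE ffunE.
transitivity (\sum_g \sum_k act (x k * hcomp gA (k * g^-1)%g (y g))
                 (hcomp (gmod_deg M) (g * h^-1)%g (v h))).
  by apply: eq_bigr => g _; rewrite ffunE act_suml.
rewrite exchange_big; apply: eq_bigr => k _; rewrite !linear_sum.
apply: eq_bigr => g _; rewrite act_mul comp_lfunE /=.
rewrite (hcomp_act _ _ (gmod_graded M) (hcomp_mem _ _ _)).
by rewrite invMg invgK mulgA mulgKV.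
Qed.

Definition smash_mod : fmod smash :=
  Fmod smash_act_linear smash_act_1 smash_act_mul.

End SmashModule.

(* v (x) p_g *)
Definition pure_tensor (V : vectType K) (v : V) (g : gT) : {ffun gT -> V} :=
  [ffun h => v *+ (h == g)].

Lemma smash_mul_pure (a b : A) g h :
  (pure_tensor a g : smash) * pure_tensor b h = pure_tensor (a * hcomp gA (g * h^-1)%g b) h.
Proof.
apply/ffunP => k; rewrite !ffunE (bigD1 g) //= big1 ?addr0 => [|i ig].
  rewrite !ffunE eqxx mulr1n raddfMn mulrnAr /=.
  by case: eqP => [->|].
by rewrite ffunE (negPf ig) mulr0n mul0r.
Qed.

Lemma smash_act_pure (M : gmod) (a : A) (m : M) g h :
  act (pure_tensor a g : smash) (pure_tensor m h : smash_mod M) =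
  pure_tensor (act a (hcomp (gmod_deg M) (g * h^-1)%g m)) h.
Proof.
rewrite /= lfunE; apply/ffunP => k; rewrite !ffunE (bigD1 g) //= big1 ?addr0.
  rewrite !ffunE eqxx mulr1n !raddfMn.
  by case: eqP => [->|].
move=> i ig; rewrite ffunE (negPf ig) mulr0n.
by rewrite act0 zero_lfunE.
Qed.

(* Graded projective resolution of X, for homogeneous components gX of X: the
   modules P n are graded and the maps preserve degrees. *)
Record gresolution (X : fmod A) (gX : gT -> {vspace X}) := Gresolution {
  gres :> resolution X;
  gres_deg : forall n, gT -> {vspace gres n};
  gres_graded : forall n, graded_module (gres_deg n);
  gres_d_deg : forall n g x,
    x \in gres_deg n.+1 g -> res_d gres n x \in gres_deg n g;
  gres_aug_deg : forall g x, x \in gres_deg 0 g -> res_aug gres x \in gX g }.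

(* The homogeneous components of A / J(A) are the images of those of A. They form
   a grading when J(A) is a graded ideal, as is the case when the characteristic
   of K does not divide the order of G. *)
Definition top_deg (g : gT) : {vspace top_mod A} :=
  (quotv_pi fullv (jacobson A) @: gA g)%VS.

Section ExtGrading.
Variables (X : fmod A) (gX : gT -> {vspace X}) (P : gresolution gX).
Variables (Y : fmod A) (gY : gT -> {vspace Y}).

(* Maps P i -> Y sending degree h to degree h g, for all h *)
Definition hom_deg i (g : gT) : {vspace 'Hom(P i, Y)} :=
  vspace_of (fun f : 'Hom(P i, Y) => forall h x, x \in gres_deg P i h -> f x \in gY (h * g)%g).

Lemma hom_degP i g (f : 'Hom(P i, Y)) :
  f \in hom_deg i g <->
  (forall h x, x \in gres_deg P i h -> f x \in gY (h * g)%g).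
Proof.
apply: vspace_ofP => [h x _ | k u v uP vP h x xh]; first by rewrite zero_lfunE mem0v.
by rewrite add_lfunE scale_lfunE memvD ?memvZ ?uP ?vP.
Qed.

(* Ext^i(X, Y)_g *)
Definition ext_deg i (g : gT) : {vspace Ext P Y i} :=
  (quotv_pi _ _ @: (cocycles P Y i :&: hom_deg i g))%VS.

End ExtGrading.

(* E # G^*, where gE i is the G-grading of E i; degree i is E i (x) KG^*. *)
Definition posgr_smash (E : posgr K) (gE : forall i, gT -> {vspace E i}) : posgr K :=
  @Posgr K (fun i => {ffun gT -> E i}) [ffun=> posgr_one E]
    (fun i j x y => [ffun h =>
       \sum_g posgr_mul (x g) (hcomp (gE j) (g * h^-1)%g (y h))]).

End Smash.

Section Submodule.
Variables (K : fieldType) (B : falgType K) (X : fmod B).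
Variables (U : {vspace X}) (smU : submodule U).

Definition sub_inc : 'Hom(subvs_of U, X) := linfun vsval.

Definition sub_act (b : B) : 'End(subvs_of U) :=
  (linfun (vsproj U) \o (act b \o sub_inc))%VF.

Lemma sub_act_val b u : vsval (sub_act b u) = act b (vsval u).
Proof.
rewrite /sub_act 2!comp_lfunE (lfunE (vsproj U)) (lfunE vsval) /=.
by rewrite vsprojK //; apply: smU; apply: subvsP.
Qed.

Lemma sub_act_linear : linear sub_act.
Proof.
move=> k a b; apply/lfunP => u; apply: val_inj.
rewrite /= sub_act_val add_lfunE scale_lfunE linearP /= !sub_act_val.
by rewrite act_linear add_lfunE scale_lfunE.
Qed.

Lemma sub_act_1 : sub_act 1 = \1%VF.
Proof.
by apply/lfunP => u; apply: val_inj; rewrite /= sub_act_val act_1 !id_lfunE.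
Qed.

Lemma sub_act_mul a b : sub_act (a * b) = (sub_act a \o sub_act b)%VF.
Proof.
apply/lfunP => u; apply: val_inj.
by rewrite /= comp_lfunE !sub_act_val act_mul comp_lfunE.
Qed.

Definition sub_mod : fmod B := Fmod sub_act_linear sub_act_1 sub_act_mul.

Lemma sub_inc_hom : is_hom (sub_inc : 'Hom(sub_mod, X)).
Proof. by move=> b x; rewrite !(lfunE vsval); apply: sub_act_val. Qed.

Lemma sub_inc_ker : lker sub_inc = 0%VS.
Proof.
apply/eqP/lker0P => u v; rewrite !(lfunE vsval); exact: val_inj.
Qed.

Lemma sub_inc_img : limg sub_inc = U.
Proof.
apply/vspaceP => v; apply/memv_imgP/idP => [[u _ ->] | vU].
  by rewrite lfunE; apply: subvsP.
by exists (vsproj U v); rewrite ?memvf // (lfunE vsval) /= vsprojK.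
Qed.

End Submodule.

Section Free.
Variables (K : fieldType) (B : falgType K) (I : finType).

Definition free_act_fun (b : B) (f : {ffun I -> B}) : {ffun I -> B} :=
  [ffun i => b * f i].

Lemma free_act_fun_linear b : linear (free_act_fun b).
Proof. by move=> k f g; apply/ffunP => i; rewrite !ffunE mulrDr scalerAr. Qed.

HB.instance Definition _ b :=
  GRing.isLinear.Build K {ffun I -> B} {ffun I -> B} _ (free_act_fun b)
    (free_act_fun_linear b).

Definition free_act b : 'End({ffun I -> B}) := linfun (free_act_fun b).

Lemma free_act_linear : linear free_act.
Proof.
move=> k a b; apply/lfunP => f; rewrite add_lfunE scale_lfunE !lfunE /=.
by apply/ffunP => i; rewrite !ffunE mulrDl scalerAl.
Qed.

Lemma free_act_1 : free_act 1 = \1%VF.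
Proof.
apply/lfunP => f; rewrite id_lfunE !lfunE /=.
by apply/ffunP => i; rewrite ffunE mul1r.
Qed.

Lemma free_act_mul a b : free_act (a * b) = (free_act a \o free_act b)%VF.
Proof.
apply/lfunP => f; rewrite comp_lfunE !lfunE /=.
by apply/ffunP => i; rewrite !ffunE mulrA.
Qed.

Definition free_mod : fmod B := Fmod free_act_linear free_act_1 free_act_mul.

Definition free_gen (i : I) : free_mod := [ffun j => ((j == i)%:R : B)].

Section Map.
Variables (X : fmod B) (x : I -> X).

Definition free_map_fun (f : {ffun I -> B}) : X := \sum_i act (f i) (x i).

Lemma free_map_fun_linear : linear free_map_fun.
Proof.
move=> k f g; rewrite /free_map_fun scaler_sumr -big_split.
by apply: eq_bigr => i _; rewrite !ffunE act_linear add_lfunE scale_lfunE.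
Qed.

HB.instance Definition _ :=
  GRing.isLinear.Build K {ffun I -> B} X _ free_map_fun free_map_fun_linear.

Definition free_map : 'Hom(free_mod, X) := linfun free_map_fun.

Lemma free_mapE f : free_map f = \sum_i act (f i) (x i).
Proof. by rewrite lfunE. Qed.

Lemma free_map_hom : is_hom free_map.
Proof.
move=> b f; rewrite !free_mapE linear_sum /=; apply: eq_bigr => i _.
by rewrite lfunE /= ffunE act_mul comp_lfunE.
Qed.

Lemma free_map_gen i : free_map (free_gen i) = x i.
Proof.
rewrite free_mapE (bigD1 i) //= ffunE eqxx act_1 id_lfunE big1 ?addr0 //.
by move=> j /negPf ji; rewrite ffunE ji act0 zero_lfunE.
Qed.

End Map.

Lemma free_gen_sum (f : free_mod) : f = \sum_i act (f i) (free_gen i).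
Proof.
apply/ffunP => j; rewrite sum_ffunE (bigD1 j) //= lfunE /= !ffunE eqxx mulr1.
by rewrite big1 ?addr0 // => i /negPf ij; rewrite lfunE /= !ffunE eq_sym ij mulr0.
Qed.

Lemma free_projective : projective free_mod.
Proof.
move=> Y Z p f hp sp hf.
exists (free_map (fun i => p^-1%VF (f (free_gen i)))); first exact: free_map_hom.
apply/lfunP => u; rewrite comp_lfunE free_mapE linear_sum /=.
rewrite [in RHS](free_gen_sum u) linear_sum /=; apply: eq_bigr => i _.
by rewrite hp limg_lfunVK ?sp ?memvf // hf.
Qed.

End Free.

Section Build.
Variables (K : fieldType) (B : falgType K) (S : Type) (obj cov : S -> fmod B).
Variables (eps : forall s, 'Hom(cov s, obj s)) (next : S -> S).
Variable inc : forall s, 'Hom(obj (next s), cov s).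
Hypothesis cov_projective : forall s, projective (cov s).
Hypothesis eps_hom : forall s, is_hom (eps s).
Hypothesis eps_surj : forall s, limg (eps s) = fullv.
Hypothesis inc_hom : forall s, is_hom (inc s).
Hypothesis inc_inj : forall s, lker (inc s) = 0%VS.
Hypothesis inc_img : forall s, limg (inc s) = lker (eps s).

Let st s n := iter n next s.
Let d s n : 'Hom(cov (st s n.+1), cov (st s n)) :=
  (inc (st s n) \o eps (st s n.+1))%VF.

Fact build_d_hom s n : is_hom (d s n).
Proof. exact: is_hom_comp. Qed.

Fact build_d_img s n : limg (d s n) = lker (eps (st s n)).
Proof. by rewrite limg_comp eps_surj inc_img. Qed.

Fact build_exact s n : limg (d s n.+1) = lker (d s n).
Proof.
rewrite build_d_img; apply/vspaceP => x; rewrite !memv_ker comp_lfunE.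
by rewrite -[RHS]memv_ker inc_inj memv0.
Qed.

Definition build_resolution s : resolution (obj s) :=
  @Resolution K B (obj s) (fun n => cov (st s n)) (d s) (eps s)
    (fun n => @cov_projective (st s n)) (@build_d_hom s) (@eps_hom s)
    (@build_exact s) (@build_d_img s 0) (@eps_surj s).

End Build.

Section ResolutionExists.
Variables (K : fieldType) (B : falgType K).

Lemma lker_submodule (X Y : fmod B) (f : 'Hom(X, Y)) :
  is_hom f -> submodule (lker f).
Proof.
by move=> hf b x; rewrite !memv_ker hf => /eqP->; rewrite linear0.
Qed.

Definition cover_gen (X : fmod B) (i : 'I_(\dim (fullv : {vspace X}))) : X :=
  (vbasis (fullv : {vspace X}))`_i.

Definition cover_eps (X : fmod B) := free_map (@cover_gen X).

Lemma free_map_surj (I : finType) (X : fmod B) (x : I -> X) (s : seq X) :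
  {in s, forall v, exists i, x i = v} -> <<s>>%VS = fullv ->
  limg (free_map x) = fullv.
Proof.
move=> xs spans; apply/eqP; rewrite eqEsubv subvf /= -spans; apply/span_subvP => v /xs[i <-].
by rewrite -free_map_gen memv_img ?memvf.
Qed.

Lemma cover_eps_surj X : limg (cover_eps X) = fullv.
Proof.
apply: (free_map_surj (s := vbasis fullv)).
  by move=> v /tnthP[i ->]; exists i; rewrite (tnth_nth 0).
exact: span_basis (vbasisP _).
Qed.

Theorem resolution_exists (X : fmod B) : inhabited (resolution X).
Proof.
pose ker Y := lker_submodule (free_map_hom (@cover_gen Y)).
constructor; apply: (@build_resolution K B (fmod B) id
  (fun Y => free_mod B 'I_(\dim (fullv : {vspace Y}))) cover_eps
  (fun Y => sub_mod (ker Y)) (fun Y => sub_inc (lker (cover_eps Y)))).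
- by move=> Y; apply: free_projective.
- by move=> Y; apply: free_map_hom.
- exact: cover_eps_surj.
- by move=> Y; apply: sub_inc_hom.
- by move=> Y; apply: sub_inc_ker.
- by move=> Y; apply: sub_inc_img.
Qed.

End ResolutionExists.

Section FinitelyGenerated.
Variables (K : fieldType) (B : falgType K) (M : lmodType B) (n : nat).
Variable e : 'I_n -> M.
Hypothesis e_gen : forall m, exists c : {ffun 'I_n -> B}, \sum_i c i *: e i = m.

Let q (f : free_mod B 'I_n) : M := \sum_i (f : {ffun 'I_n -> B}) i *: e i.

Let qD f g : q (f + g) = q f + q g.
Proof. by rewrite -big_split; apply: eq_bigr => i _; rewrite ffunE scalerDl. Qed.

Let q0 : q 0 = 0.
Proof. by rewrite /q big1 // => i _; rewrite ffunE scale0r. Qed.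

Let qB f g : q (f - g) = q f - q g.
Proof. by apply: (addIr (q g)); rewrite -qD !subrK. Qed.

Let qZ b f : q (act b f) = b *: q f.
Proof.
by rewrite scaler_sumr; apply: eq_bigr => i _; rewrite lfunE ffunE scalerA.
Qed.

Let U : {vspace free_mod B 'I_n} := vspace_of (fun f => q f = 0).

Let UP f : f \in U <-> q f = 0.
Proof.
apply: vspace_ofP => [|k u v u0 v0]; first exact: q0.
suff -> : k *: u = act (k%:A : B) u by rewrite qD qZ u0 v0 scaler0 addr0.
by rewrite lfunE; apply/ffunP => i; rewrite !ffunE mulr_algl.
Qed.

Let smU : submodule U.
Proof. by move=> b f /UP f0; apply/UP; rewrite qZ f0 scaler0. Qed.

Theorem fmod_of_finitely_generated :
  exists (X : fmod B) (phi : X -> M),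
    [/\ bijective phi, {morph phi : x y / x + y} &
        forall b x, phi (act b x) = b *: phi x].
Proof.
exists (quot_mod smU), (fun x => q (quotv_repr fullv U x)).
have q_pi f : q (quotv_repr fullv U (quotv_pi fullv U f)) = q f.
  by apply/eqP; rewrite -subr_eq0 -qB; apply/eqP/UP/quot_repr_pi.
have inv m : exists f, q f = m by have [c <-] := e_gen m; exists c.
split=> [|x y|b x]; last 2 first.
- by rewrite linearD qD.
- by rewrite -{1}(quotv_reprK x) /= (quot_act_pi smU) q_pi qZ.
exists (fun m => quotv_pi fullv U
  (sval (constructive_indefinite_description _ (inv m)))) => [x|m].
  case: constructive_indefinite_description => f /= qf.
  rewrite -[RHS](quotv_reprK x).
  apply: (@quot_piE K B (free_mod B _) U); apply/UP.
  by rewrite qB qf subrr.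
by case: constructive_indefinite_description => f /= qf; rewrite q_pi.
Qed.

End FinitelyGenerated.

Lemma is_grading_proj (K : fieldType) (V : vectType K) (I : finType)
    (Vg : I -> {vspace V}) (pr : I -> V -> V) :
  (forall i v, pr i v \in Vg i) -> (forall v, \sum_i pr i v = v) ->
  (forall i u, (forall j, u j \in Vg j) -> pr i (\sum_j u j) = u i) ->
  is_grading Vg.
Proof.
move=> pr_mem pr_sum pr_uniq; split.
  apply/directv_sum_unique => us vs usV vsV.
  apply/eqP/forall_inP => [eq_uv i _|eq_uv].
    by rewrite -(pr_uniq i us) ?eq_uv ?pr_uniq // => j; [apply: vsV | apply: usV].
  by apply: eq_bigr => i _; apply/eqP/eq_uv.
apply/eqP; rewrite eqEsubv subvf; apply/subvP => v _.
by rewrite -(pr_sum v); apply: memv_sumr => i _; apply: pr_mem.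
Qed.

Section GradedResolutionExists.
Variables (K : fieldType) (gT : finGroupType) (A : falgType K) (gA : galg gT A).

Section GradedSub.
Variables (X : gmod gA) (U : {vspace X}) (smU : submodule U).
Hypothesis grU : forall g x, x \in U -> hcomp (gmod_deg X) g x \in U.

Definition gsub_deg g : {vspace sub_mod smU} :=
  (sub_inc U @^-1: gmod_deg X g)%VS.

Lemma gsub_degP g (u : sub_mod smU) :
  (u \in gsub_deg g) = (vsval (u : subvs_of U) \in gmod_deg X g).
Proof. by rewrite -memv_preim (lfunE vsval). Qed.

Lemma gsub_graded : graded_module gA gsub_deg.
Proof.
have [grX actX] := gmod_graded X; split.
  pose pr g (u : sub_mod smU) : sub_mod smU :=
    vsproj U (hcomp (gmod_deg X) g (vsval (u : subvs_of U))).
  have val_pr g u : vsval (pr g u) = hcomp (gmod_deg X) g (vsval (u : subvs_of U)).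
    by rewrite vsprojK //; apply: grU; apply: subvsP.
  apply: (is_grading_proj (pr := pr)) => [g u|u|g u udeg].
  - by rewrite gsub_degP val_pr hcomp_mem.
  - apply: val_inj; rewrite /= raddf_sum /= -[RHS](hcomp_sum _ grX).
    by apply: eq_bigr => g _; apply: val_pr.
  - apply: val_inj; rewrite /= val_pr raddf_sum /= hcomp_uniq // => j.
    by rewrite -gsub_degP.
move=> g h a x ag; rewrite !gsub_degP => xh.
by have := actX _ _ _ _ ag xh; rewrite -(sub_act_val smU).
Qed.

Definition gsub : gmod gA := Gmod gsub_graded.

End GradedSub.

Section GradedFree.
Variable X : gmod gA.

Let I : finType := {h : gT & 'I_(\dim (gmod_deg X h))}.

Definition gfree_deg g : {vspace free_mod A I} :=
  vspace_of (fun f : free_mod A I =>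
    forall i, (f : {ffun I -> A}) i \in gA (g * (tag i)^-1)%g).

Lemma gfree_degP g (f : free_mod A I) :
  f \in gfree_deg g <->
  forall i, (f : {ffun I -> A}) i \in gA (g * (tag i)^-1)%g.
Proof.
apply: vspace_ofP => [i|k u v uP vP i]; first by rewrite ffunE mem0v.
by rewrite !ffunE memvD ?memvZ.
Qed.

Lemma gfree_graded : graded_module gA gfree_deg.
Proof.
split=> [|g h a f ag /gfree_degP fh]; last first.
  by apply/gfree_degP => i; rewrite lfunE ffunE -mulgA; apply: galg_mul.
pose pr g (f : free_mod A I) : free_mod A I :=
  [ffun i => hcomp gA (g * (tag i)^-1)%g ((f : {ffun I -> A}) i)].
apply: (is_grading_proj (pr := pr)) => [g f|f|g u udeg].
- by apply/gfree_degP => i; rewrite ffunE hcomp_mem.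
- apply/ffunP => i; rewrite sum_ffunE -[RHS](hcomp_sum _ (galg_grading gA)).
  by rewrite [RHS](reindex_inj (mulIg (tag i)^-1)%g); apply: eq_bigr => g _; rewrite ffunE.
- apply/ffunP => i; rewrite ffunE sum_ffunE.
  pose w k : A := (u (k * tag i)%g : {ffun I -> A}) i.
  have -> : \sum_j (u j : {ffun I -> A}) i = \sum_j w j.
    rewrite (reindex_inj (mulIg (tag i))); apply: eq_bigr => j _.
    by rewrite /w.
  rewrite hcomp_uniq; first by rewrite /w mulgKV.
    exact: galg_grading.
  by move=> k; have /gfree_degP/(_ i) := udeg (k * tag i)%g; rewrite mulgK.
Qed.

Definition gfree : gmod gA := Gmod gfree_graded.

Definition gcover_gen (i : I) : X := (vbasis (gmod_deg X (tag i)))`_(tagged i).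

Definition gcover_eps : 'Hom(gfree, X) := free_map gcover_gen.

Lemma gcover_eps_deg g x : x \in gfree_deg g -> gcover_eps x \in gmod_deg X g.
Proof.
move/gfree_degP => xg; rewrite free_mapE; apply: memv_suml => i _.
have [_ actX] := gmod_graded X; rewrite -[g](mulgKV (tag i)); apply: actX.
  exact: xg.
by apply: vbasis_mem; rewrite mem_nth // size_tuple.
Qed.

Lemma gcover_eps_surj : limg gcover_eps = fullv.
Proof.
have [[_ full] _] := gmod_graded X.
apply/eqP; rewrite eqEsubv subvf /= -full; apply/subv_sumP => g _.
rewrite -(span_basis (vbasisP (gmod_deg X g))); apply/span_subvP => v /tnthP[j ->].
pose i : I := Tagged (fun h => 'I_(\dim (gmod_deg X h))) j.
have -> : tnth (vbasis (gmod_deg X g)) j = gcover_gen i by rewrite (tnth_nth 0).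
by rewrite -(free_map_gen gcover_gen) memv_img ?memvf.
Qed.

Lemma gcover_ker_graded g x :
  x \in lker gcover_eps -> hcomp gfree_deg g x \in lker gcover_eps.
Proof.
have [grX _] := gmod_graded X; have [grF _] := gfree_graded.
rewrite !memv_ker => /eqP x0; apply/eqP.
have <- := @hcomp_uniq _ _ _ (gmod_deg X)
  (fun k => gcover_eps (hcomp gfree_deg k x)) g grX
  (fun k => gcover_eps_deg (hcomp_mem _ _ _)).
by rewrite -linear_sum hcomp_sum //= x0 linear0.
Qed.

End GradedFree.

Theorem gresolution_exists (X : gmod gA) :
  inhabited (gresolution gA (gmod_deg X)).
Proof.
pose eps_hom Y : is_hom (gcover_eps Y) := free_map_hom (@gcover_gen Y).
pose nxt (Y : gmod gA) : gmod gA :=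
  gsub (lker_submodule (eps_hom Y)) (@gcover_ker_graded Y).
pose inc Y : 'Hom(nxt Y, gfree Y) := sub_inc (lker (gcover_eps Y)).
have prj (Y : gmod gA) : projective (gfree Y) := @free_projective K A _.
have inc_hom Y : is_hom (inc Y) := @sub_inc_hom K A _ _ (lker_submodule (@eps_hom Y)).
pose R := @build_resolution K A (gmod gA) (@gmod_mod _ _ _ gA) gfree gcover_eps
  nxt inc prj eps_hom gcover_eps_surj inc_hom (fun Y => sub_inc_ker _)
  (fun Y => sub_inc_img _) X.
constructor; apply: (@Gresolution K gT A gA X (gmod_deg X) R
  (fun n => gfree_deg (iter n nxt X))).
- by move=> n; apply: gfree_graded.
- move=> n g x xg; rewrite /= comp_lfunE (lfunE vsval).
  have := @gcover_eps_deg (iter n.+1 nxt X) g x xg.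
  by rewrite gsub_degP.
- by move=> g x; apply: gcover_eps_deg.
Qed.

End GradedResolutionExists.

(* Main.v *)
From HB Require Import structures.
From mathcomp Require Import all_boot all_order all_fingroup all_algebra all_field.
From Stdlib Require Import ClassicalEpsilon.
Require Import Defs.

Set Implicit Arguments.
Unset Strict Implicit.
Unset Printing Implicit Defensive.

Import GRing.Theory.
Local Open Scope ring_scope.

(** Write S for the smash product of A with the dual group algebra, and X# for
    the S-module attached to a graded A-module X. The theorem rests on two facts.

    The first is formal. The algebra A embeds in S by a |-> a # 1, and X |-> X#
    is left adjoint to restriction along this embedding: the unit X -> X# is the
    diagonal map m |-> sum of the m (x) p_h, and an A-linear map X -> N extends
    uniquely to an S-linear map X# -> N because the m_u (x) p_h with m_u of
    degree u is obtained from the diagonal of m_u by the idempotent 1 # p_(u h)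
    ([smash_decomp], [smash_adjoint_hom]). The functor X |-> X# is
    exact and, restriction being exact, it preserves projectives, so that it maps a
    graded projective resolution of X to a projective resolution of X#. As an
    A-module, Y# is a sum of copies of Y indexed by G. Hence Ext_S(X#, Y#) is
    Ext_A(X, Y) to the power G ([ext_slice_bijective]). An S-linear map with
    slices f_k : X -> Y sends m (x) p_h to the sum of the
    (f_k)_(h k^-1)(m) (x) p_k, and composing lifts slice by slice turns this into
    the multiplication rule of the smash product ([ext_slice_yoneda]).

    The second fact is that J(S) consists of the functions G -> A with
    values in J(A) ([jacobson_smash]); in particular J(A) is a graded ideal and
    S / J(S) is (A / J)# ([top_smash]). One inclusion follows
    from the invariance of J(S) under the action of G on S. The other
    is where the characteristic enters: by an averaging argument over G, as in
    Maschke's theorem, S / J(S) is still semisimple when restricted to A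
    ([complemented_coind]), so J(A) kills it.

    Being quasi-Koszul says that certain spans of products are everything. In a
    smash product such a span is computed value by value
    ([prod_span_smash]), so the property holds over S exactly when it holds
    over A. Since Ext is computed from arbitrary resolutions and Yoneda
    products from arbitrary lifts, all of this is preceded by the comparison
    theorem and its consequences for Ext. *)

(** * Comparison of projective resolutions *)

Section LinearMaps.
Variables (K : fieldType).

Lemma limg_le_lker (U V W : vectType K) (g : 'Hom(V, W)) (f : 'Hom(U, V)) :
  (g \o f)%VF = 0 -> (limg f <= lker g)%VS.
Proof.
move=> gf0; apply/subvP => _ /memv_imgP[u _ ->].
by rewrite memv_ker -comp_lfunE gf0 zero_lfunE.
Qed.

Lemma limg_le_comp0 (U V W : vectType K) (g : 'Hom(V, W)) (f : 'Hom(U, V)) :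
  (limg f <= lker g)%VS -> (g \o f)%VF = 0.
Proof.
move=> /subvP gf; apply/lfunP => u; rewrite comp_lfunE zero_lfunE.
by apply/eqP; rewrite -memv_ker gf ?memv_img ?memvf.
Qed.

Lemma lfun_bijective (U V : vectType K) (f : 'Hom(U, V)) :
  (forall u, f u = 0 -> u = 0) -> (forall v, exists u, f u = v) -> bijective f.
Proof.
move=> inj surj; have kf : lker f == 0%VS.
  by rewrite -subv0; apply/subvP => u; rewrite memv_ker memv0 => /eqP/inj->.
exists (f^-1)%VF; first exact: lker0_lfunK.
by move=> v; have [u <-] := surj v; rewrite lker0_lfunK.
Qed.

End LinearMaps.

Section Comparison.
Variables (K : fieldType) (B : falgType K).

Lemma is_homB (X Y : fmod B) (f g : 'Hom(X, Y)) :
  is_hom f -> is_hom g -> is_hom (f - g).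
Proof. by move=> hf hg; rewrite addrC -scaleN1r; apply: is_hom_linear. Qed.

Lemma is_hom_id (X : fmod B) : is_hom (\1%VF : 'Hom(X, X)).
Proof. by move=> b x; rewrite !id_lfunE. Qed.

Lemma limg_submodule (X Y : fmod B) (f : 'Hom(X, Y)) :
  is_hom f -> submodule (limg f).
Proof. by move=> hf b _ /memv_imgP[x _ ->]; rewrite -hf memv_img ?memvf. Qed.

(** Only the image of f matters: corestrict p to a surjection onto its image. *)
Lemma projective_factor (P Y Z : fmod B) (p : 'Hom(Y, Z)) (f : 'Hom(P, Z)) :
  projective P -> is_hom p -> is_hom f -> (limg f <= limg p)%VS ->
  exists2 g : 'Hom(P, Y), is_hom g & (p \o g)%VF = f.
Proof.
move=> prjP hp hf /subvP fp; set U := limg p in fp *.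
have smU : submodule U by apply: limg_submodule.
pose cr (W : fmod B) (q : 'Hom(W, Z)) : 'Hom(W, sub_mod smU) :=
  (linfun (vsproj U) \o q)%VF.
have crE (W : fmod B) (q : 'Hom(W, Z)) w :
    (limg q <= U)%VS -> vsval (cr W q w : subvs_of U) = q w.
  move=> qU; rewrite comp_lfunE (lfunE (vsproj U)) /= vsprojK //.
  by apply: (subvP qU); rewrite memv_img ?memvf.
have cr_hom (W : fmod B) (q : 'Hom(W, Z)) : (limg q <= U)%VS -> is_hom q -> is_hom (cr W q).
  move=> qU hq b w; apply: val_inj => /=.
  by rewrite (sub_act_val smU) !crE.
have fU : (limg f <= U)%VS by apply/subvP.
have [||g hg pg] := prjP Y (sub_mod smU) (cr Y p) (cr P f) (cr_hom _ _ (subvv _) hp).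
- apply/eqP; rewrite eqEsubv subvf /=; apply/subvP => z _.
  have /memv_imgP[y _ zy] : vsval (z : subvs_of U) \in U by apply: subvsP.
  apply/memv_imgP; exists y; first exact: memvf.
  by apply: val_inj; rewrite /= crE.
- exact: cr_hom.
exists g => //; apply/lfunP => x; rewrite comp_lfunE -crE // -(crE P f) //.
by rewrite -pg [in RHS]comp_lfunE.
Qed.

(** The source of the comparison is a complex of projectives rather than a
    resolution, so that it may be a resolution P (for chain maps over a module
    map) or its truncation n |-> P (n + r) (for lifts of a cocycle of degree r). *)
Section Complex.
Variables (C : nat -> fmod B) (dC : forall n, 'Hom(C n.+1, C n)).
Hypothesis C_projective : forall n, projective (C n).
Hypothesis dC_hom : forall n, is_hom (dC n).
Hypothesis dC_comp : forall n, (dC n \o dC n.+1)%VF = 0.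
Variables (Y : fmod B) (Q : resolution Y).

Definition chain_map (F : forall n, 'Hom(C n, Q n)) : Prop :=
  (forall n, is_hom (F n)) /\
  forall n, (res_d Q n \o F n.+1)%VF = (F n \o dC n)%VF.

(** Each map is chosen by projectivity from the preceding one; the invariant
    that allows the next choice is that F n composed with the differential of C has its
    image in that of Q. *)
Lemma comparison (f : 'Hom(C 0%N, Y)) :
  is_hom f -> (f \o dC 0%N)%VF = 0 ->
  exists2 F, chain_map F & (res_aug Q \o F 0%N)%VF = f.
Proof.
move=> hf fd0.
have [||F0 hF0 F0E] := projective_factor (p := res_aug Q) (@C_projective 0%N) _ hf.
- exact: res_aug_hom.
- by rewrite res_aug_surj subvf.
pose stepP n (F : 'Hom(C n, Q n)) (F' : 'Hom(C n.+1, Q n.+1)) :=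
  is_hom F' /\ (res_d Q n \o F')%VF = (F \o dC n)%VF.
pose step n F := epsilon (inhabits (0 : 'Hom(C n.+1, Q n.+1))) (@stepP n F).
have step_spec n F : is_hom F -> (limg (F \o dC n)%VF <= limg (res_d Q n))%VS ->
    stepP n F (step n F).
  move=> hF Fd; apply: epsilon_spec.
  have [||F' hF' F'E] := projective_factor (@C_projective n.+1) _ _ Fd.
  - exact: res_d_hom.
  - exact: is_hom_comp.
  by exists F'.
pose F := nat_rect (fun n => 'Hom(C n, Q n)) F0 step.
have inv n : is_hom (F n) /\ (limg (F n \o dC n)%VF <= limg (res_d Q n))%VS.
  elim: n => [|n [hF Fd]].
    by split=> //; rewrite res_exact0 limg_le_lker // comp_lfunA F0E.
  have [hF' F'E] := step_spec n _ hF Fd.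
  split=> //; rewrite res_exact limg_le_lker // comp_lfunA F'E.
  by rewrite -comp_lfunA dC_comp comp_lfun0r.
exists F => //; split=> n; first by case: (inv n).
by have [hF Fd] := inv n; case: (step_spec n _ hF Fd).
Qed.

(** The homotopy inductively corrects F, the next part of it lifting the
    defect of the preceding one. The map e is the contribution of a part of degree
    -1, which is needed when F lifts a coboundary. *)
Lemma null_homotopy F (e : 'Hom(C 0%N, Q 0%N)) :
  chain_map F -> is_hom e -> (e \o dC 0%N)%VF = 0 ->
  (res_aug Q \o F 0%N)%VF = (res_aug Q \o e)%VF ->
  forall n, exists2 s : 'Hom(C n, Q n.+1), is_hom s &
    match n return 'Hom(C n, Q n) -> Prop with
    | 0 => fun h => h = e
    | n'.+1 => fun h =>
        exists2 t : 'Hom(C n', Q n'.+1), is_hom t & h = (t \o dC n')%VF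
    end (F n - (res_d Q n \o s)%VF).
Proof.
move=> [hF Fd] he ed0 augF; elim=> [|n [s hs sE]].
  have [|||s hs sE] :=
    projective_factor (p := res_d Q 0%N) (f := F 0%N - e) (@C_projective 0%N).
  - exact: res_d_hom.
  - exact: is_homB.
  - by rewrite res_exact0 limg_le_lker // comp_lfunDr comp_lfunNr augF subrr.
  by exists s; rewrite // sE opprB addrC subrK.
have Fsd : ((F n - (res_d Q n \o s)%VF) \o dC n)%VF = 0.
  case: n s hs sE => [|n] s hs; first by move->.
  by case=> t _ ->; rewrite -comp_lfunA dC_comp comp_lfun0r.
have [|||s' hs' s'E] := projective_factor (p := res_d Q n.+1)
    (f := F n.+1 - (s \o dC n)%VF) (@C_projective n.+1).
- exact: res_d_hom.
- by apply: is_homB => //; apply: is_hom_comp.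
- rewrite res_exact limg_le_lker // comp_lfunDr comp_lfunNr Fd comp_lfunA.
  by rewrite -comp_lfunNl -comp_lfunDl.
by exists s'; rewrite // s'E; exists s; rewrite // opprB addrC subrK.
Qed.

End Complex.

End Comparison.

(** * Yoneda products computed from arbitrary representatives and lifts *)

Section ExtClasses.
Variables (K : fieldType) (B : falgType K).

Lemma res_d_comp (X : fmod B) (P : resolution X) n :
  (res_d P n \o res_d P n.+1)%VF = 0.
Proof. by apply: limg_le_comp0; rewrite res_exact. Qed.

Lemma res_aug_comp (X : fmod B) (P : resolution X) :
  (res_aug P \o res_d P 0%N)%VF = 0.
Proof. by apply: limg_le_comp0; rewrite res_exact0. Qed.

Section Fixed.
Variables (X : fmod B) (P : resolution X) (Y : fmod B).

Lemma res_aug_cocycle : res_aug P \in cocycles P X 0.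
Proof. by apply/cocyclesP; split; [apply: res_aug_hom | apply: res_aug_comp]. Qed.

Lemma ext_reprK i (x : Ext P Y i) : ext_class (ext_repr x) = x.
Proof. exact: quotv_reprK. Qed.

Lemma ext_repr_cocycle i (x : Ext P Y i) : ext_repr x \in cocycles P Y i.
Proof. exact: quotv_repr_mem. Qed.

Lemma ext_class_eq0 i (f : 'Hom(P i, Y)) :
  f \in cocycles P Y i -> (ext_class f == 0) = (f \in coboundaries P Y i).
Proof. by move=> fZ; rewrite /ext_class quotv_pi_eq0 ?coboundaries_sub. Qed.

Lemma ext_class_eq i (f g : 'Hom(P i, Y)) :
  f \in cocycles P Y i -> g \in cocycles P Y i ->
  f - g \in coboundaries P Y i -> ext_class f = ext_class g.
Proof.
move=> fZ gZ fgB; have := ext_class_eq0 (memvB fZ gZ).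
by rewrite fgB /ext_class linearB subr_eq0 => /eqP.
Qed.

Lemma ext_repr_class i (f : 'Hom(P i, Y)) :
  f \in cocycles P Y i -> ext_repr (ext_class f) - f \in coboundaries P Y i.
Proof.
move=> fZ; rewrite -ext_class_eq0 ?memvB ?ext_repr_cocycle //.
by rewrite /ext_class linearB /= quotv_reprK subrr.
Qed.

End Fixed.

Lemma cocycles_postcomp (X : fmod B) (P : resolution X) (Y Z : fmod B) i
    (g : 'Hom(Y, Z)) (f : 'Hom(P i, Y)) :
  is_hom g -> f \in cocycles P Y i -> (g \o f)%VF \in cocycles P Z i.
Proof.
move=> hg /cocyclesP[hf fd]; apply/cocyclesP; split; first exact: is_hom_comp.
by rewrite -comp_lfunA fd comp_lfun0r.
Qed.

Lemma coboundaries_postcomp (X : fmod B) (P : resolution X) (Y Z : fmod B) i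
    (g : 'Hom(Y, Z)) (f : 'Hom(P i, Y)) :
  is_hom g -> f \in coboundaries P Y i -> (g \o f)%VF \in coboundaries P Z i.
Proof.
case: i f => [|i] f hg; first by rewrite !memv0 => /eqP->; rewrite comp_lfun0r.
case/coboundariesP=> t ht ->; apply/coboundariesP; exists (g \o t)%VF.
  exact: is_hom_comp.
by rewrite comp_lfunA.
Qed.

End ExtClasses.

Section Yoneda.
Variables (K : fieldType) (B : falgType K).
Variables (X Y : fmod B) (P : resolution X) (Q : resolution Y) (r : nat).

Lemma lift_exists (f : 'Hom(P r, Y)) :
  f \in cocycles P Y r -> exists F : forall n, 'Hom(P (n + r)%N, Q n), is_lift f F.
Proof.
case/cocyclesP=> hf fd0.
have [|||F [hF Fd] FE] := comparison (C := fun n => P (n + r)%N)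
    (dC := fun n => res_d P (n + r)%N) _ _ _ Q hf fd0.
- by move=> n; apply: res_projective.
- by move=> n; apply: res_d_hom.
- by move=> n; apply: res_d_comp.
by exists F.
Qed.

Lemma lift_spec (f : 'Hom(P r, Y)) :
  f \in cocycles P Y r -> is_lift f (lift Q f).
Proof. by move=> fZ; apply: epsilon_spec; apply: lift_exists. Qed.

(** A chain map that lifts a coboundary is null-homotopic up to terms that factor
    through the differential of P; a cocycle g kills the homotopy. *)
Lemma lift_coboundary (F : forall n, 'Hom(P (n + r)%N, Q n)) (Z : fmod B) l
    (g : 'Hom(Q l, Z)) :
  chain_map (C := fun n => P (n + r)%N) (fun n => res_d P (n + r)%N) F ->
  (res_aug Q \o F 0%N)%VF \in coboundaries P Y r -> g \in cocycles Q Z l ->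
  (g \o F l)%VF \in coboundaries P Z (l + r).
Proof.
move=> cF augF /cocyclesP[hg gd0].
(* For r = j.+1, the coboundary factors as t \o res_d P j, and t lifts to Q 0. *)
have [e [he ed0 eE eB]] : exists e : 'Hom(P r, Q 0%N), [/\ is_hom e,
    (e \o res_d P r)%VF = 0, (res_aug Q \o F 0%N)%VF = (res_aug Q \o e)%VF
    & e \in coboundaries P (Q 0%N) r].
  case: (r) F cF augF => [|j] F cF.
    rewrite memv0 => /eqP augF; exists 0; split; first exact: is_hom0.
    - by rewrite comp_lfun0l.
    - by rewrite augF comp_lfun0r.
    - exact: mem0v.
  case/coboundariesP=> t ht augF.
  have [||t' ht' t'E] := projective_factor (p := res_aug Q) (@res_projective _ _ _ P j) _ ht.
  - exact: res_aug_hom.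
  - by rewrite res_aug_surj subvf.
  exists (t' \o res_d P j)%VF; split.
  - by apply: is_hom_comp => //; apply: res_d_hom.
  - by rewrite -comp_lfunA res_d_comp comp_lfun0r.
  - by rewrite augF comp_lfunA t'E.
  - by apply/coboundariesP; exists t'.
have [|||s hs] := null_homotopy (C := fun n => P (n + r)%N)
   (dC := fun n => res_d P (n + r)%N) _ _ _ cF he ed0 eE l.
- by move=> n; apply: res_projective.
- by move=> n; apply: res_d_hom.
- by move=> n; apply: res_d_comp.
have -> : (g \o F l)%VF = (g \o (F l - (res_d Q l \o s)%VF))%VF.
  by rewrite comp_lfunDr comp_lfunNr comp_lfunA gd0 comp_lfun0l subr0.
case: l g hg gd0 s hs => [|l] g hg gd0 s hs.
  by move->; apply: coboundaries_postcomp.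
case=> t ht ->; apply: coboundaries_postcomp => //.
by apply/coboundariesP; exists t.
Qed.

Lemma lift_cocycle (f : 'Hom(P r, Y))
    (F : forall n, 'Hom(P (n + r)%N, Q n)) (Z : fmod B) l (g : 'Hom(Q l, Z)) :
  is_lift f F -> g \in cocycles Q Z l ->
  (g \o F l)%VF \in cocycles P Z (l + r).
Proof.
move=> [hF _ Fd] /cocyclesP[hg gd0]; apply/cocyclesP; split.
  exact: is_hom_comp.
by rewrite -comp_lfunA -Fd comp_lfunA gd0 comp_lfun0l.
Qed.

(** Well-definedness of the Yoneda product, in the form used everywhere below: it
    may be computed from any cocycles and any lift. *)
Lemma yonedaE (f : 'Hom(P r, Y))
    (F : forall n, 'Hom(P (n + r)%N, Q n)) (Z : fmod B) l (g : 'Hom(Q l, Z)) :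
  f \in cocycles P Y r -> g \in cocycles Q Z l -> is_lift f F ->
  yoneda (ext_class f : Ext P Y r) (ext_class g : Ext Q Z l) =
  ext_class (g \o F l)%VF.
Proof.
move=> fZ gZ liftF; rewrite /yoneda.
set g' := ext_repr _; set f' := ext_repr (ext_class f).
have f'Z : f' \in cocycles P Y r by apply: ext_repr_cocycle.
have g'Z : g' \in cocycles Q Z l by apply: ext_repr_cocycle.
have liftF' := lift_spec f'Z; set F' := lift Q f' in liftF' *.
apply: ext_class_eq; [exact: (lift_cocycle liftF') | exact: (lift_cocycle liftF) |].
have -> : (g' \o F' l)%VF - (g \o F l)%VF =
    ((g' - g) \o F' l)%VF + (g \o (F' l - F l))%VF.
  by rewrite comp_lfunDl comp_lfunDr comp_lfunNl comp_lfunNr addrA subrK.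
have [hF Faug Fd] := liftF; have [hF' F'aug F'd] := liftF'.
apply: memvD; last first.
  apply: (lift_coboundary (F := fun n => F' n - F n)) => //.
    split=> n; first exact: is_homB.
    by rewrite comp_lfunDr comp_lfunDl comp_lfunNr comp_lfunNl Fd F'd.
  by rewrite comp_lfunDr comp_lfunNr Faug F'aug; apply: ext_repr_class.
have := ext_repr_class gZ; rewrite -/g'.
case: (l) (g) (g') => [|j] h h'.
  by rewrite memv0 => /eqP->; rewrite comp_lfun0l mem0v.
case/coboundariesP=> t ht ->; apply/coboundariesP; exists (t \o F' j)%VF.
  exact: is_hom_comp.
by rewrite -!comp_lfunA F'd.
Qed.

End Yoneda.

(** * Functoriality of Ext in resolutions and coefficients *)

Section ExtMap.
Variables (K : fieldType) (B : falgType K).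

Section Def.
Variables (X X' Y Y' : fmod B) (P : resolution X) (P' : resolution X').
Variables (phi : forall n, 'Hom(P' n, P n)) (beta : 'Hom(Y, Y')).

Definition ext_map_fun i (x : Ext P Y i) : Ext P' Y' i :=
  ext_class (beta \o ext_repr x \o phi i)%VF.

Lemma ext_map_fun_linear i : linear (@ext_map_fun i).
Proof.
move=> k x y; rewrite /ext_map_fun /ext_repr linearP.
by rewrite comp_lfunDr comp_lfunDl -comp_lfunZr -comp_lfunZl /ext_class linearP.
Qed.

HB.instance Definition _ i :=
  GRing.isLinear.Build K (Ext P Y i) (Ext P' Y' i) _ (@ext_map_fun i)
    (@ext_map_fun_linear i).

Definition ext_map i : 'Hom(Ext P Y i, Ext P' Y' i) := linfun (@ext_map_fun i).

Hypothesis (phi_chain : chain_map (res_d P') phi) (beta_hom : is_hom beta).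

Lemma ext_map_cocycle i f :
  f \in cocycles P Y i -> (beta \o f \o phi i)%VF \in cocycles P' Y' i.
Proof.
have [hphi phid] := phi_chain.
move=> /cocyclesP[hf fd]; apply/cocyclesP; split.
  by apply: is_hom_comp => //; apply: is_hom_comp.
by rewrite -!comp_lfunA -phid (comp_lfunA f) fd comp_lfun0l comp_lfun0r.
Qed.

Lemma ext_map_coboundary i f :
  f \in coboundaries P Y i -> (beta \o f \o phi i)%VF \in coboundaries P' Y' i.
Proof.
have [hphi phid] := phi_chain.
case: i f => [|i] f; first by rewrite !memv0 => /eqP->; rewrite comp_lfun0r comp_lfun0l.
case/coboundariesP=> t ht ->; apply/coboundariesP; exists (beta \o t \o phi i)%VF.
  by apply: is_hom_comp => //; apply: is_hom_comp.
by rewrite -!comp_lfunA phid.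
Qed.

Lemma ext_mapE i f :
  f \in cocycles P Y i -> ext_map i (ext_class f) = ext_class (beta \o f \o phi i)%VF.
Proof.
move=> fZ; rewrite lfunE; apply: ext_class_eq.
- by apply: ext_map_cocycle; apply: ext_repr_cocycle.
- exact: ext_map_cocycle.
rewrite -comp_lfunNl -comp_lfunDl -comp_lfunNr -comp_lfunDr.
by apply: ext_map_coboundary; apply: ext_repr_class.
Qed.

End Def.

(** theta is homotopic to the identity, as both lift the identity of X. *)
Lemma chain_endo_coboundary (X Y : fmod B) (P : resolution X)
    (theta : forall n, 'Hom(P n, P n)) i f :
  chain_map (res_d P) theta -> (res_aug P \o theta 0%N)%VF = res_aug P ->
  f \in cocycles P Y i -> (f \o theta i)%VF - f \in coboundaries P Y i.
Proof.
move=> [htheta thetad] thetaE fZ; have /cocyclesP[hf fd] := fZ.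
pose D n := theta n - \1%VF.
have cD : chain_map (res_d P) D.
  split=> n; first by apply: is_homB => //; apply: is_hom_id.
  by rewrite comp_lfunDr comp_lfunDl comp_lfunNr comp_lfunNl thetad comp_lfun1l comp_lfun1r.
have [|||s hs] := null_homotopy (@res_projective _ _ _ P) (@res_d_hom _ _ _ P)
   (@res_d_comp _ _ _ P) (e := 0) cD _ _ _ i.
- exact: is_hom0.
- by rewrite comp_lfun0l.
- by rewrite comp_lfun0r comp_lfunDr comp_lfunNr thetaE comp_lfun1r subrr.
have -> : (f \o theta i)%VF - f = (f \o (D i - (res_d P i \o s)%VF))%VF.
  by rewrite comp_lfunDr comp_lfunNr comp_lfunA fd comp_lfun0l subr0
             comp_lfunDr comp_lfunNr comp_lfun1r.
case: i f s hf {fZ fd} hs => [|i] f s hf hs.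
  by move=> ->; rewrite comp_lfun0r mem0v.
by case=> t ht ->; apply: coboundaries_postcomp => //; apply/coboundariesP; exists t.
Qed.

Lemma ext_map_cancel (X X' Y Y' : fmod B) (P : resolution X) (P' : resolution X')
    (phi : forall n, 'Hom(P' n, P n)) (phi' : forall n, 'Hom(P n, P' n))
    (beta : 'Hom(Y, Y')) (beta' : 'Hom(Y', Y)) i :
  chain_map (res_d P') phi -> chain_map (res_d P) phi' ->
  is_hom beta -> is_hom beta' ->
  (res_aug P \o phi 0%N \o phi' 0%N)%VF = res_aug P -> (beta' \o beta)%VF = \1%VF ->
  cancel (@ext_map X X' Y Y' P P' phi beta i) (@ext_map X' X Y' Y P' P phi' beta' i).
Proof.
move=> cphi cphi' hb hb' phiE bE x; rewrite -[x in RHS]ext_reprK -[in LHS](ext_reprK x).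
have fZ := ext_repr_cocycle x; set f := ext_repr x in fZ *.
rewrite !ext_mapE ?ext_map_cocycle //.
have -> : (beta' \o (beta \o f \o phi i) \o phi' i)%VF = (f \o (phi i \o phi' i))%VF.
  by rewrite !comp_lfunA bE comp_lfun1l.
have ctheta : chain_map (res_d P) (fun n => (phi n \o phi' n)%VF).
  case: cphi cphi' => hphi phid [hphi' phid']; split=> n; first exact: is_hom_comp.
  by rewrite comp_lfunA phid -comp_lfunA phid' comp_lfunA.
have fB := chain_endo_coboundary ctheta _ fZ.
apply: ext_class_eq => //; last by apply: fB; rewrite comp_lfunA.
have [htheta thetad] := ctheta; have /cocyclesP[hf fd] := fZ.
apply/cocyclesP; split; first exact: is_hom_comp.
by rewrite -(comp_lfunA f) -thetad comp_lfunA fd comp_lfun0l.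
Qed.

(** Write f for a representative of x and F, F' for lifts of f and of its
    image. Then F \o phi and theta \o F' lift the same cocycle f \o phi, because
    beta' undoes beta; computing one Yoneda product with both lifts gives the
    two sides. *)
Lemma ext_map_yoneda (X X' Y Y' Z Z' : fmod B)
    (P : resolution X) (P' : resolution X') (Q : resolution Y) (Q' : resolution Y')
    (phi : forall n, 'Hom(P' n, P n)) (theta : forall n, 'Hom(Q' n, Q n))
    (beta : 'Hom(Y, Y')) (beta' : 'Hom(Y', Y)) (gamma : 'Hom(Z, Z')) r l
    (x : Ext P Y r) (y : Ext Q Z l) :
  chain_map (res_d P') phi -> chain_map (res_d Q') theta ->
  is_hom beta -> is_hom beta' -> is_hom gamma ->
  (res_aug Q \o theta 0%N)%VF = (beta' \o res_aug Q')%VF ->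
  (beta' \o beta)%VF = \1%VF ->
  ext_map phi gamma (l + r) (yoneda x y) =
  yoneda (ext_map phi beta r x) (ext_map theta gamma l y).
Proof.
move=> cphi ctheta hb hb' hg thetaE bE.
rewrite -[x]ext_reprK -[y]ext_reprK.
have fZ := ext_repr_cocycle x; set f := ext_repr x in fZ *.
have gZ := ext_repr_cocycle y; set g := ext_repr y in gZ *.
have [F liftF] := lift_exists Q fZ.
have f'Z := ext_map_cocycle cphi hb fZ.
have [F' liftF'] := lift_exists Q' f'Z.
have g'Z := ext_map_cocycle ctheta hg gZ.
rewrite (yonedaE fZ gZ liftF) !ext_mapE ?(lift_cocycle liftF) //.
rewrite (yonedaE f'Z g'Z liftF').
have f1Z : (f \o phi r)%VF \in cocycles P' Y r.
  by rewrite -[f]comp_lfun1l; apply: ext_map_cocycle => //; apply: is_hom_id.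
have g1Z := cocycles_postcomp hg gZ.
have [hphi phid] := cphi; have [htheta thetad] := ctheta.
have lift1 : is_lift (f \o phi r)%VF
    (fun n => (F n \o phi (n + r)%N)%VF : 'Hom(P' (n + r)%N, Q n)).
  have [hF Faug Fd] := liftF; split=> [n||n]; first exact: is_hom_comp.
    by rewrite comp_lfunA Faug.
  by rewrite comp_lfunA Fd -!comp_lfunA phid.
have lift2 : is_lift (f \o phi r)%VF
    (fun n => (theta n \o F' n)%VF : 'Hom(P' (n + r)%N, Q n)).
  have [hF Faug Fd] := liftF'; split=> [n||n]; first exact: is_hom_comp.
    by rewrite comp_lfunA thetaE -comp_lfunA Faug !comp_lfunA bE comp_lfun1l.
  by rewrite comp_lfunA thetad -!comp_lfunA Fd.
have := yonedaE f1Z g1Z lift1; rewrite (yonedaE f1Z g1Z lift2) => E.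
by rewrite !comp_lfunA in E *; rewrite E.
Qed.

End ExtMap.

(** * Invariance of Yoneda algebras and of the Koszul conditions *)

Section GradedAlgebraIso.
Variables (K : fieldType).

Lemma prod_span_morph (E1 E2 E3 F1 F2 F3 : vectType K)
    (m : E1 -> E2 -> E3) (n : F1 -> F2 -> F3)
    (f1 : 'Hom(E1, F1)) (f2 : 'Hom(E2, F2)) (f3 : 'Hom(E3, F3))
    (U : {vspace E1}) (W : {vspace E2}) (U' : {vspace F1}) (W' : {vspace F2}) z :
  (forall x y, f3 (m x y) = n (f1 x) (f2 y)) ->
  (forall x, x \in U -> f1 x \in U') -> (forall y, y \in W -> f2 y \in W') ->
  z \in prod_span m U W -> f3 z \in prod_span n U' W'.
Proof.
move=> fm fU fW /prod_spanP zT; apply/prod_spanP => T nT.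
rewrite memv_preim; apply: zT => x y xU yW.
by rewrite -memv_preim fm nT ?fU ?fW.
Qed.

Lemma posgr_iso_sym (E F : posgr K) : posgr_iso E F -> posgr_iso F E.
Proof.
case=> phi [bij phi1 phiM].
have ker i : lker (phi i) == 0%VS by apply/lker0P/bij_inj/bij.
have im i y : phi i ((phi i)^-1%VF y) = y.
  by have [g gK Kg] := bij i; rewrite -{1}(Kg y) lker0_lfunK // Kg.
exists (fun i => (phi i)^-1%VF); split=> [i||i j x y].
- by exists (phi i); [apply: im | apply: lker0_lfunK].
- by rewrite -phi1 lker0_lfunK.
- by rewrite -{1}(im i x) -{1}(im j y) -phiM lker0_lfunK.
Qed.

Lemma posgr_iso_trans (E F H : posgr K) :
  posgr_iso E F -> posgr_iso F H -> posgr_iso E H.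
Proof.
case=> phi [bij phi1 phiM] [psi [bij' psi1 psiM]].
exists (fun i => (psi i \o phi i)%VF); split=> [i||i j x y].
- apply: (@eq_bij _ _ (psi i \o phi i)) => [|x]; last by rewrite /= comp_lfunE.
  exact: bij_comp.
- by rewrite comp_lfunE phi1 psi1.
- by rewrite !comp_lfunE phiM psiM.
Qed.

Lemma generated01_iso (E F : posgr K) :
  posgr_iso E F -> generated01 E -> generated01 F.
Proof.
case=> phi [bij _ phiM] genE i.
have powE k x : x \in deg1_pow E k -> phi k.+1 x \in deg1_pow F k.
  elim: k x => [|k IHk] x; first by move=> _; apply: memvf.
  apply: (prod_span_morph (f1 := phi k.+1) (f2 := phi 1%N)) => // [u v|v _].
    exact: (phiM k.+1 1%N u v).
  by rewrite memvf.
apply/eqP; rewrite eqEsubv subvf /=; apply/subvP => y _.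
have [g gK Kg] := bij i.+2; rewrite -(Kg y); apply: powE.
by rewrite genE memvf.
Qed.

End GradedAlgebraIso.

Section Invariance.
Variables (K : fieldType) (B : falgType K).

Definition inverse_homs (X Y : fmod B) (a : 'Hom(X, Y)) (b : 'Hom(Y, X)) : Prop :=
  [/\ is_hom a, is_hom b, (b \o a)%VF = \1%VF & (a \o b)%VF = \1%VF].

Lemma inverse_homs_id (X : fmod B) : inverse_homs (\1%VF : 'Hom(X, X)) \1%VF.
Proof. by split; rewrite ?comp_lfun1l //; apply: is_hom_id. Qed.

Lemma inverse_homs_sym (X Y : fmod B) (a : 'Hom(X, Y)) (b : 'Hom(Y, X)) :
  inverse_homs a b -> inverse_homs b a.
Proof. by case. Qed.

Lemma chain_map_exists (X X' : fmod B) (P : resolution X) (P' : resolution X')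
    (a : 'Hom(X', X)) :
  is_hom a -> exists2 phi : forall n, 'Hom(P' n, P n), chain_map (res_d P') phi &
    (res_aug P \o phi 0%N)%VF = (a \o res_aug P')%VF.
Proof.
move=> ha; apply: comparison => //.
- exact: res_projective.
- exact: res_d_hom.
- exact: res_d_comp.
- by apply: is_hom_comp => //; apply: res_aug_hom.
- by rewrite -comp_lfunA res_aug_comp comp_lfun0r.
Qed.

Lemma ext_map_bijective (X X' Y Y' : fmod B) (P : resolution X) (P' : resolution X')
    (phi : forall n, 'Hom(P' n, P n)) (a : 'Hom(X', X)) (a' : 'Hom(X, X'))
    (b : 'Hom(Y, Y')) (b' : 'Hom(Y', Y)) i :
  inverse_homs a a' -> inverse_homs b b' -> chain_map (res_d P') phi ->
  (res_aug P \o phi 0%N)%VF = (a \o res_aug P')%VF ->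
  bijective (ext_map phi b i : Ext P Y i -> Ext P' Y' i).
Proof.
move=> [ha ha' a'a aa'] [hb hb' b'b bb'] cphi phiE.
have [phi' cphi' phi'E] := chain_map_exists P' P ha'.
exists (ext_map phi' b' i); apply: ext_map_cancel => //.
  by rewrite phiE -comp_lfunA phi'E comp_lfunA aa' comp_lfun1l.
by rewrite phi'E -comp_lfunA phiE comp_lfunA a'a comp_lfun1l.
Qed.

Lemma ext_alg_iso (X X' : fmod B) (a : 'Hom(X, X')) (b : 'Hom(X', X))
    (P : resolution X) (P' : resolution X') :
  inverse_homs a b -> posgr_iso (ext_alg P) (ext_alg P').
Proof.
move=> ab; have [ha hb ba ab1] := ab.
have [phi cphi phiE] := chain_map_exists P P' hb.
exists (fun i => ext_map phi a i : 'Hom(ext_alg P i, ext_alg P' i)).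
split=> [i||i j x y].
- by apply: (ext_map_bijective (a := b) (a' := a) (b' := b)) => //; apply: inverse_homs_sym ab.
- rewrite /= ext_mapE ?res_aug_cocycle //.
  by rewrite -comp_lfunA phiE comp_lfunA ab1 comp_lfun1l.
- exact: (ext_map_yoneda (beta' := b)).
Qed.

(** The condition defining quasi-Koszul modules, with T in place of the top of B
    and for one choice of resolutions only. *)
Definition ext1_generated (X T : fmod B) (P : resolution X) (Q : resolution T) : Prop :=
  forall i, prod_span (fun (x : Ext P T i) (y : Ext Q T 1) =>
                         yoneda x y : Ext P T i.+1) fullv fullv = fullv.

Lemma ext1_generated_iso (X X' T T' : fmod B) (a : 'Hom(X, X')) (a' : 'Hom(X', X))
    (b : 'Hom(T, T')) (b' : 'Hom(T', T)) (P : resolution X) (P' : resolution X')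
    (Q : resolution T) (Q' : resolution T') :
  inverse_homs a a' -> inverse_homs b b' ->
  ext1_generated P Q -> ext1_generated P' Q'.
Proof.
move=> aa' bb' genPQ i.
have [ha ha' _ _] := aa'; have [hb hb' b'b _] := bb'.
have [phi cphi phiE] := chain_map_exists P P' ha'.
have [theta ctheta thetaE] := chain_map_exists Q Q' hb'.
apply/eqP; rewrite eqEsubv subvf /=; apply/subvP => y _.
have [g _ Kg] := ext_map_bijective i.+1 (inverse_homs_sym aa') bb' cphi phiE.
rewrite -(Kg y).
have := @prod_span_morph K (Ext P T i) (Ext Q T 1) (Ext P T i.+1)
  (Ext P' T' i) (Ext Q' T' 1) (Ext P' T' i.+1)
  (fun x y => yoneda x y) (fun x y => yoneda x y) (ext_map phi b i)
  (ext_map theta b 1%N) (ext_map phi b i.+1) fullv fullv fullv fullv (g y).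
apply=> //.
- by move=> u v; exact: (ext_map_yoneda u v cphi ctheta hb hb' hb thetaE b'b).
- by move=> *; apply: memvf.
- by move=> *; apply: memvf.
- by have := genPQ i => ->; apply: memvf.
Qed.

(** One choice of resolutions, of X and of any module isomorphic to the top of B,
    decides whether X is quasi-Koszul. *)
Lemma quasi_koszul_modE (X T : fmod B) (b : 'Hom(top_mod B, T)) (b' : 'Hom(T, top_mod B))
    (P : resolution X) (Q : resolution T) :
  inverse_homs b b' -> quasi_koszul_mod X <-> ext1_generated P Q.
Proof.
move=> bb'; split=> [qk|gen P' Q'].
  have [Q'] := resolution_exists (top_mod B).
  exact: ext1_generated_iso (inverse_homs_id X) bb' (qk P Q').
exact: ext1_generated_iso (inverse_homs_id X) (inverse_homs_sym bb') gen.
Qed.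

End Invariance.

(** * The Jacobson radical of a finite-dimensional algebra *)

Section ExtremalSubspaces.
Variables (K : fieldType) (V : vectType K) (P : {vspace V} -> Prop).

Lemma max_vspace U : P U ->
  exists W, [/\ P W, (U <= W)%VS & forall D, P D -> (W <= D)%VS -> D = W].
Proof.
have [n] := ubnP (\dim (fullv : {vspace V}) - \dim U).
elim: n U => // n IHn U leUn PU.
have [[D [PD UD DU]] | maxU] := excluded_middle_informative
    (exists D, [/\ P D, (U <= D)%VS & D <> U]).
  have ltUD : (\dim U < \dim D)%N.
    rewrite (ltn_leqif (dimv_leqif_sup UD)); apply: contra_notN DU => DU.
    by apply/eqP; rewrite eqEsubv DU.
  have [||W [PW DW maxW]] := IHn D => //.
    rewrite -ltnS; apply: leq_trans leUn.
    by rewrite ltnS ltn_sub2l // (leq_trans ltUD) // dimvS ?subvf.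
  by exists W; split=> //; apply: subv_trans DW.
exists U; split=> // D PD UD; apply/eqP/negPn/negP => /eqP DU.
by apply: maxU; exists D.
Qed.

Lemma min_vspace U : P U ->
  exists W, P W /\ forall D, P D -> (D <= W)%VS -> D = W.
Proof.
have [n] := ubnP (\dim U); elim: n U => // n IHn U leUn PU.
have [[D [PD DU neDU]] | minU] := excluded_middle_informative
    (exists D, [/\ P D, (D <= U)%VS & D <> U]).
  apply: (IHn D) => //; rewrite -ltnS; apply: leq_trans leUn.
  by rewrite ltnS (ltn_leqif (dimv_leqif_eq DU)); apply/eqP.
exists U; split=> // D PD DU; apply/eqP/negPn/negP => /eqP neDU.
by apply: minU; exists D.
Qed.

End ExtremalSubspaces.

Section Radical.
Variables (K : fieldType) (B : falgType K).

Section Orbit.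
Variables (N : fmod B) (n : N).

Definition orbit_map_fun (b : B) : N := act b n.

Lemma orbit_map_linear : linear orbit_map_fun.
Proof. by move=> k a b; rewrite /orbit_map_fun act_linear add_lfunE scale_lfunE. Qed.

HB.instance Definition _ :=
  GRing.isLinear.Build K B N _ orbit_map_fun orbit_map_linear.

Definition orbit_map : 'Hom(B, N) := linfun orbit_map_fun.

Lemma orbit_mapE b : orbit_map b = act b n.
Proof. by rewrite lfunE. Qed.

Lemma orbit_map_hom : is_hom (orbit_map : 'Hom(regular_mod B, N)).
Proof. by move=> b x; rewrite !orbit_mapE lfunE /= act_mul comp_lfunE. Qed.

End Orbit.

Implicit Types N : fmod B.

Lemma actDl N (a b : B) (n : N) : act (a + b) n = act a n + act b n.
Proof. by rewrite -!orbit_mapE linearD. Qed.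

Lemma actBl N (a b : B) (n : N) : act (a - b) n = act a n - act b n.
Proof. by rewrite -!orbit_mapE linearB. Qed.

Lemma act1 N (n : N) : act (1 : B) n = n.
Proof. by rewrite act_1 id_lfunE. Qed.

Lemma actM N (a b : B) (n : N) : act (a * b) n = act a (act b n).
Proof. by rewrite act_mul comp_lfunE. Qed.

Lemma submodule_add N (U W : {vspace N}) :
  submodule U -> submodule W -> submodule (U + W)%VS.
Proof.
move=> sU sW b _ /memv_addP[u uU [w wW ->]].
by rewrite linearD memv_add ?sU ?sW.
Qed.

Lemma submodule_cap N (U W : {vspace N}) :
  submodule U -> submodule W -> submodule (U :&: W)%VS.
Proof. by move=> sU sW b x; rewrite !memv_cap => /andP[/sU-> /sW->]. Qed.

Lemma submodule_img N N' (f : 'Hom(N, N')) (U : {vspace N}) :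
  is_hom f -> submodule U -> submodule (f @: U)%VS.
Proof. by move=> hf sU b _ /memv_imgP[x xU ->]; rewrite -hf memv_img ?sU. Qed.

Lemma submodule_preim N N' (f : 'Hom(N, N')) (U : {vspace N'}) :
  is_hom f -> submodule U -> submodule (f @^-1: U)%VS.
Proof. by move=> hf sU b x; rewrite -!memv_preim hf; apply: sU. Qed.

Lemma submodule_full N : submodule (fullv : {vspace N}).
Proof. by move=> b x _; apply: memvf. Qed.

Lemma submodule_0 N : submodule (0%VS : {vspace N}).
Proof. by move=> b x; rewrite !memv0 => /eqP->; rewrite linear0. Qed.

Definition maximal_submodule N (W : {vspace N}) : Prop :=
  [/\ submodule W, W != fullv &
      forall D : {vspace N}, submodule D -> (W <= D)%VS -> D = W \/ D = fullv].

Lemma maximal_submodule_exists N (U : {vspace N}) :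
  submodule U -> U != fullv -> exists2 W, maximal_submodule W & (U <= W)%VS.
Proof.
move=> sU neU; pose P (D : {vspace N}) := submodule D /\ D != fullv.
have [//|W [[sW neW] UW maxW]] := @max_vspace _ _ P U.
exists W => //; split=> // D sD WD.
by have [->|/eqP neD] := D =P fullv; [right | left; apply: maxW].
Qed.

Lemma left_ideal_full (I : {vspace B}) :
  submodule (I : {vspace regular_mod B}) -> 1 \in I -> I = fullv.
Proof.
move=> sI I1; apply/eqP; rewrite eqEsubv subvf; apply/subvP => x _.
by have := sI x _ I1; rewrite /= lfunE /= mulr1.
Qed.

(** If n is not in W, then the b with b n in W form a maximal left ideal. *)
Lemma jacobson_act N (W : {vspace N}) a n :
  maximal_submodule W -> a \in jacobson B -> act a n \in W.
Proof.
move=> [sW neW maxW] aJ.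
have [nW | nW] := boolP (n \in W); first exact: sW.
rewrite -orbit_mapE memv_preim; move/jacobsonP: aJ; apply.
set I := (_ @^-1: W)%VS; have IE b : (b \in I) = (act b n \in W).
  by rewrite -memv_preim orbit_mapE.
split; first exact: submodule_preim (orbit_map_hom n) sW.
  by apply: contraNneq nW => If; have := IE 1; rewrite If memvf act1 => <-.
move=> L sL IL.
have sD : submodule (W + orbit_map n @: L)%VS.
  by apply: submodule_add => //; apply: submodule_img (orbit_map_hom n) sL.
have [WD | Df] := maxW _ sD (addvSl _ _).
  left; apply/eqP; rewrite eqEsubv IL andbT; apply/subvP => l lL.
  rewrite IE -WD -orbit_mapE; apply: (subvP (addvSr _ _)).
  exact: memv_img.
right; apply: left_ideal_full => //.
have /memv_addP[w wW [_ /memv_imgP[l lL ->] nE]] : n \in (W + orbit_map n @: L)%VS.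
  by rewrite Df memvf.
rewrite -(subrK l 1) memvD // (subvP IL) // IE actBl act1 {1}nE orbit_mapE.
by rewrite addrK.
Qed.

Lemma jacobson_mulr a s : a \in jacobson B -> a * s \in jacobson B.
Proof.
move=> aJ; apply/jacobsonP => I maxI.
by have := @jacobson_act (regular_mod B) I a s maxI aJ; rewrite /= lfunE.
Qed.

Lemma jacobson_mull a s : a \in jacobson B -> s * a \in jacobson B.
Proof. by move=> aJ; have := jacobson_submodule s aJ; rewrite /= lfunE. Qed.

(** Right multiplication by i is an endomorphism of a finite-dimensional space. *)
Lemma amulr_surj_inj (i : B) :
  limg (amulr i) = fullv <-> (forall z, z * i = 0 -> z = 0).
Proof.
have dimi := limg_ker_dim (amulr i) fullv; rewrite capfv in dimi.
split=> [im z zi | inj].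
  move: dimi; rewrite im -[RHS]add0n => /addIn/eqP; rewrite dimv_eq0 => /eqP ker0.
  by apply/eqP; rewrite -memv0 -ker0 memv_ker lfunE /= zi.
have ker0 : lker (amulr i) = 0%VS.
  apply/eqP; rewrite -subv0; apply/subvP => z.
  by rewrite memv_ker memv0 lfunE /= => /eqP/inj->.
by apply/eqP; rewrite eqEdim subvf limg_dim_eq ?leqnn // ker0 capv0.
Qed.

Lemma limg_amulr_submodule (i : B) :
  submodule (limg (amulr i) : {vspace regular_mod B}).
Proof.
move=> b _ /memv_imgP[x _ ->]; apply/memv_imgP; exists (b * x); first exact: memvf.
by rewrite /= !lfunE /= mulrA.
Qed.

(** The left ideal B (1 - x) lies in no maximal left ideal I, which would contain
    both x and 1 - x; hence it is B, and right multiplication by 1 - x is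
    bijective. *)
Lemma jacobson_regular x z : x \in jacobson B -> z * (1 - x) = 0 -> z = 0.
Proof.
move=> xJ; apply: (proj1 (amulr_surj_inj _)).
apply/eqP/negPn/negP => neL.
have [I maxI LI] := maximal_submodule_exists (@limg_amulr_submodule (1 - x)) neL.
have xI : x \in (I : {vspace B}) by move/jacobsonP: xJ; apply.
case: maxI => sI /eqP neI _; apply: neI; apply: left_ideal_full => //.
rewrite -(subrK x 1) memvD // (subvP LI) //.
by apply/memv_imgP; exists 1; rewrite ?memvf // lfunE /= mul1r.
Qed.

(** If a is not in the maximal left ideal I, then 1 = i + c a with i in I, and
    right multiplication by i = 1 - c a is onto by assumption, so I is B. *)
Lemma mem_jacobson a :
  (forall c z, z * (1 - c * a) = 0 -> z = 0) -> a \in jacobson B.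
Proof.
move=> reg; apply/jacobsonP => I maxI; have [sI /eqP neI maxI'] := maxI.
apply/negPn/negP => aI; apply: neI.
have sD : submodule (I + limg (amulr a) : {vspace regular_mod B})%VS.
  by apply: submodule_add => //; apply: limg_amulr_submodule.
have aD : a \in (I + limg (amulr a))%VS.
  apply: (subvP (addvSr _ _)); apply/memv_imgP; exists 1; first exact: memvf.
  by rewrite lfunE /= mul1r.
have [DI | Df] := maxI' _ sD (addvSl _ _); first by rewrite DI (negPf aI) in aD.
have /memv_addP[i iI [_ /memv_imgP[c _ ->] E1]] : (1 : B) \in (I + limg (amulr a))%VS.
  by rewrite Df memvf.
apply: left_ideal_full => //.
have iE : i = 1 - c * a by rewrite E1 lfunE /= addrK.
have /memv_imgP[z _ ->] : (1 : B) \in limg (amulr i).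
  by rewrite (proj2 (amulr_surj_inj i)) ?memvf // iE; apply: reg.
by rewrite lfunE; have := sI z _ iI; rewrite /= lfunE.
Qed.

Lemma jacobson_auto (s t : 'End(B)) x :
  {morph s : a b / a * b} -> cancel s t -> cancel t s ->
  x \in jacobson B -> s x \in jacobson B.
Proof.
move=> sM sK tK /jacobsonP xJ; apply/jacobsonP => I [sI neI maxI].
rewrite memv_preim; apply: xJ; split.
- move=> b y; rewrite -!memv_preim /= lfunE /= sM => yI.
  by have := sI (s b) _ yI; rewrite /= lfunE.
- apply: contraNneq neI => If; rewrite eqEsubv subvf; apply/subvP => y _.
  by rewrite -(tK y) memv_preim If memvf.
move=> L sL IL.
have sSL : submodule ((s @: L)%VS : {vspace regular_mod B}).
  move=> b _ /memv_imgP[y yL ->]; rewrite /= lfunE /= -(tK b) -sM memv_img //.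
  by have := sL (t b) _ yL; rewrite /= lfunE.
have ISL : (I <= s @: L)%VS.
  apply/subvP => y yI; rewrite -(tK y) memv_img // (subvP IL) // -memv_preim.
  by rewrite tK.
have SLE y : (y \in L) = (s y \in (s @: L)%VS).
  apply/idP/memv_imgP => [yL | [y' y'L /(can_inj sK)->//]]; by exists y.
case: (maxI _ sSL ISL) => E; [left | right]; apply/vspaceP => y.
  by rewrite SLE E memv_preim.
by rewrite SLE E !memvf.
Qed.

(** Semisimplicity, as every module here is finite-dimensional. *)
Definition complemented N : Prop :=
  forall U : {vspace N}, submodule U ->
  exists C : {vspace N}, [/\ submodule C, (U :&: C = 0)%VS & (U + C = fullv)%VS].

(** Suppose that m = a n is not 0. A submodule W maximal among those that avoid m is a
    maximal submodule: if D strictly contains W, then so does W + E for a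
    nonzero complement E of D, and both contain m, whereas they meet in W.
    But a maximal submodule contains a n. *)
Lemma complemented_jacobson N a (n : N) :
  complemented N -> a \in jacobson B -> act a n = 0.
Proof.
move=> cN aJ; set m := act a n; apply/eqP/negPn/negP => m0.
pose P (W : {vspace N}) := submodule W /\ m \notin W.
have [|W [[sW mW] _ maxW]] := @max_vspace _ _ P 0%VS.
  by split; [apply: submodule_0 | rewrite memv0].
suff maxW' : maximal_submodule W by rewrite (jacobson_act _ maxW' aJ) in mW.
split=> // [|D sD WD]; first by apply: contraNneq mW => ->; apply: memvf.
have [mD | mD] := boolP (m \in D); last by left; apply: maxW.
right; have [E [sE DE0 DEf]] := cN D sD.
have mWE : m \notin (W + E)%VS.
  apply: contra mW => /memv_addP[w wW [e eE mE]].
  have : e \in (D :&: E)%VS.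
    by rewrite memv_cap eE andbT -[e](addKr w) -mE addrC memvB // (subvP WD).
  by rewrite DE0 memv0 => /eqP e0; rewrite mE e0 addr0.
have WE : (W + E)%VS = W by apply: maxW; rewrite ?addvSl //; split=> //; apply: submodule_add.
rewrite -DEf; apply/esym/addv_idPl; apply: subv_trans WD.
by rewrite -WE addvSr.
Qed.

(** Take C minimal with U + C = B. If z in C and U were outside a
    maximal left ideal I, then C = (C :&: I) + B z would allow to replace C by C :&: I. *)
Lemma left_ideal_complement (U : {vspace regular_mod B}) :
  submodule U -> exists C : {vspace regular_mod B},
    [/\ submodule C, (U + C = fullv)%VS & (U :&: C <= jacobson B)%VS].
Proof.
move=> sU; pose P (C : {vspace regular_mod B}) := submodule C /\ (U + C = fullv)%VS.
have [|C [[sC UC] minC]] := @min_vspace _ _ P fullv.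
  by split; [apply: submodule_full | rewrite addvf].
exists C; split=> //; apply/subvP => z; rewrite memv_cap => /andP[zU zC].
apply/jacobsonP => I maxI; have [sI neI maxI'] := maxI.
apply/negPn/negP => zI.
have zI' : z \in (I + limg (amulr z) : {vspace regular_mod B})%VS.
  apply: (subvP (addvSr _ _)); apply/memv_imgP; exists 1; first exact: memvf.
  by rewrite lfunE /= mul1r.
have Iz : (I + limg (amulr z))%VS = fullv.
  have sD : submodule (I + limg (amulr z) : {vspace regular_mod B})%VS.
    by apply: submodule_add => //; apply: limg_amulr_submodule.
  by case: (maxI' _ sD (addvSl _ _)) => // E; rewrite E (negPf zI) in zI'.
suff CI : (C :&: I)%VS = C by move: zC; rewrite -CI memv_cap (negPf zI) andbF.
apply: minC; last exact: capvSl.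
split; first exact: submodule_cap.
apply/eqP; rewrite eqEsubv subvf; apply/subvP => x _.
have /memv_addP[u uU [c cC ->]] : x \in (U + C)%VS by rewrite UC memvf.
have /memv_addP[i iI [_ /memv_imgP[b _ ->] cE]] : c \in (I + limg (amulr z))%VS.
  by rewrite Iz memvf.
have bz : amulr z b = act b (z : regular_mod B) by rewrite /= !lfunE.
have iC : i \in C by rewrite -[i](addrK (amulr z b)) -cE memvB // bz sC.
rewrite cE [i + _]addrC addrA memv_add ?memv_cap ?iC ?iI //.
by rewrite memvD // bz sU.
Qed.

(** Take C maximal with U :&: C = 0. If m is not in U + C, split B into the left ideal L of
    the b with b m in U + C and a left ideal E that meets L inside J(B): as
    J(B) kills m, the submodule E m meets U + C in 0 and can be added to C. *)
Lemma jacobson_killed_complemented N :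
  (forall a (n : N), a \in jacobson B -> act a n = 0) -> complemented N.
Proof.
move=> JN U sU; pose P (C : {vspace N}) := submodule C /\ (U :&: C = 0)%VS.
have [|C [[sC UC] _ maxC]] := @max_vspace _ _ P 0%VS.
  by split; [apply: submodule_0 | rewrite capv0].
exists C; split=> //; apply/eqP; rewrite eqEsubv subvf; apply/subvP => m _.
have sUC := submodule_add sU sC.
have [E [sE LE LEJ]] := left_ideal_complement (submodule_preim (orbit_map_hom m) sUC).
have C'C : (C + orbit_map m @: E)%VS = C.
  apply: maxC; last exact: addvSl.
  split; first by apply: submodule_add => //; apply: submodule_img (orbit_map_hom m) sE.
  apply/eqP; rewrite -subv0; apply/subvP => u; rewrite memv_cap => /andP[uU].
  case/memv_addP=> c cC [_ /memv_imgP[e eE ->] uE].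
  have e0 : act e m = 0.
    apply: JN; apply: (subvP LEJ); rewrite memv_cap eE andbT -memv_preim.
    by rewrite -[X in X \in _](addKr c) -uE addrC memv_add ?memvN.
  by rewrite -UC memv_cap uU uE orbit_mapE e0 addr0.
have /memv_addP[l lL [e eE E1]] : (1 : B) \in (orbit_map m @^-1: (U + C) + E)%VS.
  by rewrite LE memvf.
rewrite -[m]act1 E1 actDl memvD //; first by rewrite -orbit_mapE memv_preim.
apply: (subvP (addvSr _ _)); rewrite -C'C; apply: (subvP (addvSr _ _)).
by rewrite -orbit_mapE memv_img.
Qed.

Lemma top_mod_killed a (x : top_mod B) : a \in jacobson B -> act a x = 0.
Proof.
move=> aJ; rewrite -(quotv_reprK x) (quot_act_pi (@jacobson_submodule _ B)).
apply/eqP; rewrite quotv_pi_eq0 ?subvf ?memvf //.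
by rewrite /= lfunE; apply: jacobson_mulr.
Qed.

End Radical.

(** * The Jacobson radical of a smash product *)

Section SmashElements.
Variables (K : fieldType) (gT : finGroupType) (A : falgType K) (gA : galg gT A).
Local Notation S := (smash_alg gA).

(** a # 1 *)
Definition smash_emb (a : A) : S := [ffun=> a].

(** a # p_g *)
Definition smash_pure (a : A) (g : gT) : S := pure_tensor a g.

Lemma smash_embE a h : smash_emb a h = a.
Proof. by rewrite ffunE. Qed.

Lemma smash_pureE a g h : smash_pure a g h = a *+ (h == g).
Proof. by rewrite ffunE. Qed.

Lemma smash_mulE (x y : S) h : (x * y) h = \sum_g x g * hcomp gA (g * h^-1)%g (y h).
Proof. by rewrite [LHS]ffunE. Qed.

Lemma smash_pureM a b g h :
  smash_pure a g * smash_pure b h = smash_pure (a * hcomp gA (g * h^-1)%g b) h.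
Proof. exact: smash_mul_pure. Qed.

Lemma smash_emb_pure a b h : smash_emb a * smash_pure b h = smash_pure (a * b) h.
Proof.
apply/ffunP => k; rewrite smash_mulE !smash_pureE.
under eq_bigr => g _ do rewrite smash_embE.
rewrite -mulr_sumr; have [->|kh] := eqVneq k h; last first.
  by rewrite !mulr0n big1 ?mulr0 // => g _; rewrite raddf0.
rewrite !mulr1n; congr (a * _).
by rewrite -[RHS](hcomp_sum _ (galg_grading gA)) [RHS](reindex_inj (mulIg (h^-1)%g)).
Qed.

Lemma smash_mul_pr (x : S) g : x * smash_pure 1 g = smash_pure (x g) g.
Proof.
apply/ffunP => k; rewrite smash_mulE !smash_pureE.
have [->|kg] := eqVneq k g; last first.
  by rewrite big1 // => h _; rewrite raddf0 mulr0.
rewrite (bigD1 g) //= big1 ?addr0 => [|h hg]; rewrite mulr1n;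
  rewrite (hcomp_id _ (galg_one gA)) -eq_mulgV1.
  by rewrite eqxx mulr1.
by rewrite (negPf hg) mulr0.
Qed.

Lemma smash_pure_sum (x : S) : x = \sum_g smash_pure (x g) g.
Proof.
apply/ffunP => k; rewrite sum_ffunE (bigD1 k) //= smash_pureE eqxx big1 ?addr0 // => g gk.
by rewrite smash_pureE eq_sym (negPf gk).
Qed.

Lemma smash_emb_sum a : smash_emb a = \sum_g smash_pure a g.
Proof. by rewrite [LHS]smash_pure_sum; apply: eq_bigr => g _; rewrite smash_embE. Qed.

Lemma smash_emb1 : smash_emb 1 = 1.
Proof. by []. Qed.

Lemma smash_pr_sum : \sum_g smash_pure 1 g = 1.
Proof. by rewrite -smash_emb_sum. Qed.

Lemma smash_embM a b : smash_emb (a * b) = smash_emb a * smash_emb b.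
Proof.
rewrite (smash_emb_sum b) mulr_sumr (smash_emb_sum (a * b)).
by apply: eq_bigr => g _; rewrite smash_emb_pure.
Qed.

Lemma smash_emb_linear : linear smash_emb.
Proof. by move=> k a b; apply/ffunP => h; rewrite !ffunE. Qed.

Lemma smash_pr_emb_pr a k l :
  smash_pure 1 k * (smash_emb a * smash_pure 1 l) =
  smash_emb (hcomp gA (k * l^-1)%g a) * smash_pure 1 l.
Proof. by rewrite !smash_emb_pure smash_pureM !mulr1 mul1r. Qed.

(** The action of G on the smash product by algebra automorphisms, which
    translates the idempotents 1 # p_h. *)
Definition smash_shift_fun (w : gT) (x : S) : S := [ffun h => x (h * w)%g].

Lemma smash_shift_linear w : linear (smash_shift_fun w).
Proof. by move=> k x y; apply/ffunP => h; rewrite !ffunE. Qed.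

HB.instance Definition _ w :=
  GRing.isLinear.Build K S S _ (smash_shift_fun w) (smash_shift_linear w).

Definition smash_shift w : 'End(S) := linfun (smash_shift_fun w).

Lemma smash_shiftE w x h : (smash_shift w x : S) h = x (h * w)%g.
Proof. by rewrite lfunE /= ffunE. Qed.

Lemma smash_shiftK w : cancel (smash_shift w) (smash_shift w^-1%g).
Proof. by move=> x; apply/ffunP => h; rewrite !smash_shiftE mulgKV. Qed.

Lemma smash_shiftM w : {morph smash_shift w : x y / x * y}.
Proof.
move=> x y; apply/ffunP => h; rewrite smash_shiftE !ffunE.
rewrite (reindex_inj (mulIg w)) /=; apply: eq_bigr => g _.
by rewrite !smash_shiftE invMg mulgA mulgK.
Qed.

Lemma jacobson_smash_pure a g h :
  smash_pure a g \in jacobson S -> smash_pure a h \in jacobson S.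
Proof.
pose w := (h^-1 * g)%g.
have -> : smash_pure a h = smash_shift w (smash_pure a g).
  apply/ffunP => k; rewrite smash_shiftE !ffunE; congr (_ *+ (nat_of_bool _)).
  by rewrite /w mulgA -{2}[g]mul1g (inj_eq (mulIg g)) -eq_mulgV1.
apply: (jacobson_auto (t := smash_shift w^-1%g)); first exact: smash_shiftM.
  exact: smash_shiftK.
by rewrite -{2}(invgK w); apply: smash_shiftK.
Qed.

End SmashElements.

Section Restriction.
Variables (K : fieldType) (gT : finGroupType) (A : falgType K) (gA : galg gT A).
Local Notation S := (smash_alg gA).

Section Restr.
Variable N : fmod S.

Definition restr_act (a : A) : 'End(N) := act (smash_emb gA a).

Lemma restr_act_linear : linear restr_act.
Proof. by move=> k a b; rewrite /restr_act smash_emb_linear act_linear. Qed.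

Lemma restr_act_1 : restr_act 1 = \1%VF.
Proof. by rewrite /restr_act smash_emb1 act_1. Qed.

Lemma restr_act_mul a b : restr_act (a * b) = (restr_act a \o restr_act b)%VF.
Proof. by rewrite /restr_act smash_embM act_mul. Qed.

Definition restr_mod : fmod A := Fmod restr_act_linear restr_act_1 restr_act_mul.

End Restr.

Section Coind.
Variable X : fmod A.

(** The coinduced module: an A-module X is made graded by taking one copy of X
    in each degree, a homogeneous a of degree s mapping the copy of degree g to
    that of degree s g. *)
Definition coind_act_fun (x : S) (f : {ffun gT -> X}) : {ffun gT -> X} :=
  [ffun k => \sum_g act (hcomp gA (k * g^-1)%g (x g)) (f g)].

Lemma coind_act_fun_linear x : linear (coind_act_fun x).
Proof.
move=> c f f'; apply/ffunP => k; rewrite !ffunE scaler_sumr -big_split.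
by apply: eq_bigr => g _; rewrite !ffunE linearP.
Qed.

HB.instance Definition _ x :=
  GRing.isLinear.Build K {ffun gT -> X} {ffun gT -> X} _ (coind_act_fun x)
    (coind_act_fun_linear x).

Definition coind_act (x : S) : 'End({ffun gT -> X}) := linfun (coind_act_fun x).

Lemma coind_actE x f k :
  coind_act x f k = \sum_g act (hcomp gA (k * g^-1)%g (x g)) (f g).
Proof. by rewrite lfunE /= ffunE. Qed.

Lemma coind_act_linear : linear coind_act.
Proof.
move=> c x y; apply/lfunP => f; rewrite add_lfunE scale_lfunE.
apply/ffunP => k; rewrite !ffunE !coind_actE scaler_sumr -big_split.
apply: eq_bigr => g _; rewrite !ffunE linearP act_linear.
by rewrite add_lfunE scale_lfunE.
Qed.

Lemma coind_act_1 : coind_act 1 = \1%VF.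
Proof.
apply/lfunP => f; rewrite id_lfunE; apply/ffunP => k; rewrite coind_actE.
rewrite (bigD1 k) //= big1 ?addr0 => [|g gk];
  rewrite ffunE (hcomp_id _ (galg_one gA)) -eq_mulgV1.
  by rewrite eqxx act1.
by rewrite eq_sym (negPf gk) act0 zero_lfunE.
Qed.

Lemma coind_act_mul x y : coind_act (x * y) = (coind_act x \o coind_act y)%VF.
Proof.
apply/lfunP => f; rewrite comp_lfunE; apply/ffunP => k; rewrite !coind_actE.
under [RHS]eq_bigr => g _ do rewrite coind_actE linear_sum.
rewrite exchange_big /=; apply: eq_bigr => h _.
rewrite smash_mulE linear_sum act_suml; apply: eq_bigr => g _.
rewrite /= (hcomp_mul _ _ (hcomp_mem gA _ _)) actM.
by rewrite invMg invgK mulgA mulgKV.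
Qed.

Definition coind_mod : fmod S := Fmod coind_act_linear coind_act_1 coind_act_mul.

End Coind.

(** An element x = sum of x_g # p_g of J(S) acts on the copy of N in degree g through the
    homogeneous components of x_g. On the part of N of degree w, the component
    of degree k g^-1 acts as (1 # p_(k g^-1 w)) (x_g # p_w), which is in J(S) by
    invariance under G. *)
Lemma coind_killed (N : fmod S) :
  (forall x (n : N), x \in jacobson S -> act x n = 0) ->
  forall x (f : coind_mod (restr_mod N)), x \in jacobson S -> act x f = 0.
Proof.
move=> JN x f xJ; apply/ffunP => k; rewrite [LHS]coind_actE ffunE big1 // => g _.
set n := f g; set b := hcomp gA _ _.
have -> : act b (n : restr_mod N) =
    \sum_w act (smash_emb gA b * smash_pure gA 1 w) n.
  by rewrite -act_suml -mulr_sumr smash_pr_sum mulr1.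
apply: big1 => w _; apply: JN; rewrite smash_emb_pure mulr1.
have -> : smash_pure gA b w = smash_pure gA 1 (k * g^-1 * w)%g * smash_pure gA (x g) w.
  by rewrite smash_pureM mul1r mulgK.
apply: jacobson_mull; apply: (@jacobson_smash_pure _ _ _ _ _ g).
by rewrite -smash_mul_pr; apply: jacobson_mulr.
Qed.

(** X embeds diagonally in the restriction of its coinduced module, and the sum
    over G maps the latter back to X; the composite is multiplication by the
    order of G. *)
Section Maschke.
Variable X : fmod A.

Definition const_fun (x : X) : {ffun gT -> X} := [ffun=> x].
Lemma const_fun_linear : linear const_fun.
Proof. by move=> k x y; apply/ffunP => h; rewrite !ffunE. Qed.
HB.instance Definition _ :=
  GRing.isLinear.Build K X {ffun gT -> X} _ const_fun const_fun_linear.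
Definition const_map : 'Hom(X, {ffun gT -> X}) := linfun const_fun.

Lemma const_mapE x h : const_map x h = x.
Proof. by rewrite lfunE /= ffunE. Qed.

Definition total_fun (f : {ffun gT -> X}) : X := \sum_g f g.
Lemma total_fun_linear : linear total_fun.
Proof.
move=> k f f'; rewrite /total_fun scaler_sumr -big_split.
by apply: eq_bigr => g _; rewrite !ffunE.
Qed.
HB.instance Definition _ :=
  GRing.isLinear.Build K {ffun gT -> X} X _ total_fun total_fun_linear.
Definition total_map : 'Hom({ffun gT -> X}, X) := linfun total_fun.

Lemma total_mapE f : total_map f = \sum_g f g.
Proof. by rewrite lfunE. Qed.

Lemma const_map_hom : is_hom (const_map : 'Hom(X, restr_mod (coind_mod X))).
Proof.
move=> a x; apply/ffunP => k; rewrite const_mapE [RHS]coind_actE.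
under eq_bigr => g _ do rewrite ffunE const_mapE.
rewrite -act_suml -[in LHS](hcomp_sum a (galg_grading gA)).
rewrite (reindex_inj (mulgI k)) (reindex_inj invg_inj) /=.
by rewrite (eq_bigr (fun g => hcomp gA (k * g^-1)%g a)).
Qed.

Lemma total_map_hom : is_hom (total_map : 'Hom(restr_mod (coind_mod X), X)).
Proof.
move=> a f; rewrite !total_mapE.
transitivity (\sum_k \sum_g act (hcomp gA (k * g^-1)%g a) (f g)).
  apply: eq_bigr => k _; rewrite [LHS]coind_actE.
  by apply: eq_bigr => g _; rewrite smash_embE.
rewrite exchange_big linear_sum; apply: eq_bigr => g _ /=.
rewrite -act_suml -[in RHS](hcomp_sum a (galg_grading gA)).
by rewrite [in RHS](reindex_inj (mulIg g^-1%g)).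
Qed.

End Maschke.

Lemma restr_hom (N N' : fmod S) (f : 'Hom(N, N')) :
  is_hom f -> is_hom (f : 'Hom(restr_mod N, restr_mod N')).
Proof. by move=> hf a x; apply: hf. Qed.

Hypothesis char_ndvd : (#|{: gT}|%:R != 0 :> K).

(** Maschke's averaging. A submodule U of X gives the submodule U' of functions with
    values in U. The projection r on U' along a complement yields the map
    rho, from the diagonal of X through r to X by summation over G: it has values in U
    and multiplies the elements of U by the order of G. Its kernel is a
    complement of U. *)
Lemma complemented_coind (X : fmod A) :
  complemented (coind_mod X) -> complemented X.
Proof.
move=> cF U sU; set F := coind_mod X in cF.
pose U' : {vspace F} := vspace_of (fun f : F => forall g, (f : {ffun gT -> X}) g \in U).
have U'P (f : F) : f \in U' <-> forall g, (f : {ffun gT -> X}) g \in U.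
  apply: vspace_ofP => [g|k u v uU vU g]; first by rewrite ffunE mem0v.
  by rewrite !ffunE memvD ?memvZ.
have sU' : submodule U'.
  move=> x f /U'P fU; apply/U'P => k; rewrite [X in X \in _]coind_actE.
  by apply: memv_suml => g _; apply: sU.
have [C [sC U'C0 U'Cf]] := cF U' sU'.
pose r : 'End(F) := daddv_pi U' C.
have rU f : f \in U' -> r f = f by apply: daddv_pi_id.
have rC f : f \in C -> r f = 0.
  move=> fC; have := daddv_pi_add U'C0 (_ : f \in (U' + C)%VS).
  rewrite U'Cf memvf => /(_ isT); rewrite [in X in _ + X]daddv_pi_id //.
    by move/eqP; rewrite addrC -subr_eq0 addrAC subrr add0r => /eqP.
  by rewrite capvC.
have hr : is_hom r.
  move=> x f; have /memv_addP[u uU [c cC ->]] : f \in (U' + C)%VS by rewrite U'Cf memvf.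
  rewrite !linearD /= (rU u) // (rC c) // linear0 (rU (act x u)) ?sU' //.
  by rewrite (rC (act x c)) ?sC.
pose rho : 'End(X) := (total_map X \o (r : 'End(restr_mod F)) \o const_map X)%VF.
have hrho : is_hom rho.
  have hr' : is_hom (r : 'End(restr_mod F)) by apply: restr_hom.
  exact: (is_hom_comp (is_hom_comp (@total_map_hom X) hr') (@const_map_hom X)).
have rhoU x : x \in U -> rho x = #|{: gT}|%:R *: x.
  move=> xU; rewrite !comp_lfunE (rU (const_map X x)).
    rewrite total_mapE; under eq_bigr => g _ do rewrite const_mapE.
    by rewrite sumr_const scaler_nat.
  by apply/U'P => g; rewrite const_mapE.
have rho_mem x : rho x \in U.
  rewrite !comp_lfunE total_mapE; apply: memv_suml => g _.
  by move: g; apply/U'P; apply: memv_pi.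
exists (lker rho); split; first exact: lker_submodule.
  apply/eqP; rewrite -subv0; apply/subvP => x; rewrite memv_cap memv_ker memv0.
  by case/andP=> /rhoU->; rewrite scaler_eq0 (negPf char_ndvd).
apply/eqP; rewrite eqEsubv subvf; apply/subvP => x _.
pose y := #|{: gT}|%:R^-1 *: rho x.
rewrite -(subrK y x) addrC memv_add ?memvZ // memv_ker linearB /= [rho y]linearZ /=.
by rewrite rhoU // scalerA mulVf // scale1r subrr.
Qed.

(** If x is in J(S), then by invariance so is x_h # 1, and the criterion of quasi-regularity
    descends from S to A. Conversely, S / J(S) is a module killed by J(S), hence so is
    the module coinduced from it; both are semisimple, so by averaging
    the restriction of S / J(S) to A is semisimple and killed by J(A). *)
Lemma jacobson_smash (x : S) :
  x \in jacobson S <-> forall h, x h \in jacobson A.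
Proof.
split=> [xJ h | xJ].
  have embJ : smash_emb gA (x h) \in jacobson S.
    rewrite smash_emb_sum; apply: memv_suml => g _.
    by apply: (@jacobson_smash_pure _ _ _ _ _ h); rewrite -smash_mul_pr jacobson_mulr.
  apply: mem_jacobson => c z zc.
  have := @jacobson_regular _ _ (smash_emb gA (c * x h)) (smash_emb gA z).
  rewrite {1}smash_embM jacobson_mull // => /(_ isT).
  have -> : 1 - smash_emb gA (c * x h) = smash_emb gA (1 - c * x h).
    by apply/ffunP => k; rewrite !ffunE.
  rewrite -smash_embM zc => E; have /ffunP/(_ 1%g) : smash_emb gA z = 0.
    by apply: E; apply/ffunP => k; rewrite !ffunE.
  by rewrite !ffunE.
rewrite (smash_pure_sum x); apply: memv_suml => h _.
set T := top_mod S; have JT : forall y (n : T), y \in jacobson S -> act y n = 0.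
  by move=> y n; apply: top_mod_killed.
have cT : complemented (restr_mod T).
  by apply: complemented_coind; apply: jacobson_killed_complemented (coind_killed JT).
have := complemented_jacobson
  (quotv_pi fullv (jacobson S) (smash_pure gA 1 h) : restr_mod T) cT (xJ h).
rewrite [act _ _](quot_act_pi (@jacobson_submodule _ S)) => /eqP.
by rewrite quotv_pi_eq0 ?subvf ?memvf //= lfunE /= smash_emb_pure mulr1.
Qed.

(** (1 # p_g) (a # p_1) = a_g # p_1. *)
Lemma jacobson_graded g a : a \in jacobson A -> hcomp gA g a \in jacobson A.
Proof.
move=> aJ; have pJ : smash_pure gA 1 g * smash_pure gA a 1%g \in jacobson S.
  apply: jacobson_mull; apply/jacobson_smash => h; rewrite smash_pureE.
  by case: eqP => _; rewrite ?mem0v.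
move/jacobson_smash/(_ 1%g): pJ.
by rewrite smash_pureM smash_pureE eqxx mulr1n mul1r invg1 mulg1.
Qed.

Lemma top_hcomp g a :
  graded_module gA (top_deg gA) ->
  hcomp (top_deg gA) g (quotv_pi fullv (jacobson A) a) =
  quotv_pi fullv (jacobson A) (hcomp gA g a).
Proof.
case=> grT _.
rewrite -{1}(hcomp_sum a (galg_grading gA)) linear_sum hcomp_uniq // => h.
exact/memv_img/hcomp_mem.
Qed.

Lemma top_graded : graded_module gA (top_deg gA).
Proof.
pose pi := quotv_pi fullv (jacobson A).
pose pr g (x : top_mod A) : top_mod A := pi (hcomp gA g (quotv_repr fullv _ x)).
have pr_pi g a : pr g (pi a) = pi (hcomp gA g a).
  apply: (@quot_piE _ _ (regular_mod A)); rewrite -linearB; apply: jacobson_graded.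
  exact: (@quot_repr_pi _ _ (regular_mod A)).

split; last first.
  move=> g h a _ ag /memv_imgP[x xh ->]; rewrite (quot_act_pi (@jacobson_submodule _ A)).
  by apply: memv_img; rewrite /= lfunE; apply: galg_mul.
apply: (is_grading_proj (pr := pr)) => [g x | x | g u uT].
- exact/memv_img/hcomp_mem.
- by rewrite /pr -linear_sum hcomp_sum; [apply: quotv_reprK | apply: galg_grading].
rewrite /pr !linear_sum (bigD1 g) //= big1 ?addr0 => [|h hg]; last first.
  case/memv_imgP: (uT h) => a ah ->; rewrite -/(pr _ _) pr_pi.
  by rewrite (hcomp_id _ ah) eq_sym (negPf hg) linear0.
case/memv_imgP: (uT g) => a ag ->; rewrite -/(pr _ _) pr_pi.
by rewrite (hcomp_id _ ag) eqxx.
Qed.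

Definition top_gmod : gmod gA := Gmod top_graded.

End Restriction.

(** * Homogeneous components of linear maps *)

Section FfunMaps.
Variables (K : fieldType) (I : finType) (U V : vectType K).

Definition ffun_map_fun (f : 'Hom(U, V)) (v : {ffun I -> U}) : {ffun I -> V} :=
  [ffun i => f (v i)].
Lemma ffun_map_linear f : linear (ffun_map_fun f).
Proof. by move=> k u v; apply/ffunP => i; rewrite !ffunE linearP. Qed.
HB.instance Definition _ f :=
  GRing.isLinear.Build K {ffun I -> U} {ffun I -> V} _ (ffun_map_fun f)
    (ffun_map_linear f).
Definition ffun_map f : 'Hom({ffun I -> U}, {ffun I -> V}) := linfun (ffun_map_fun f).

Lemma ffun_mapE f v i : ffun_map f v i = f (v i).
Proof. by rewrite lfunE /= ffunE. Qed.

Definition ffun_eval_fun (i : I) (v : {ffun I -> V}) : V := v i.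
Lemma ffun_eval_linear i : linear (ffun_eval_fun i).
Proof. by move=> k u v; rewrite /ffun_eval_fun !ffunE. Qed.
HB.instance Definition _ i :=
  GRing.isLinear.Build K {ffun I -> V} V _ (ffun_eval_fun i) (ffun_eval_linear i).
Definition ffun_eval i : 'Hom({ffun I -> V}, V) := linfun (ffun_eval_fun i).

Lemma ffun_evalE i v : ffun_eval i v = v i.
Proof. by rewrite lfunE. Qed.

Definition bundle_fun (f : I -> 'Hom(U, V)) (u : U) : {ffun I -> V} := [ffun i => f i u].
Lemma bundle_linear f : linear (bundle_fun f).
Proof. by move=> k u v; apply/ffunP => i; rewrite !ffunE linearP. Qed.
HB.instance Definition _ f :=
  GRing.isLinear.Build K U {ffun I -> V} _ (bundle_fun f) (bundle_linear f).
Definition bundle f : 'Hom(U, {ffun I -> V}) := linfun (bundle_fun f).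

Lemma bundleE f u i : bundle f u i = f i u.
Proof. by rewrite lfunE /= ffunE. Qed.

End FfunMaps.

Lemma ffun_map_exact (K : fieldType) (I : finType) (U V W : vectType K)
    (f : 'Hom(U, V)) (g : 'Hom(V, W)) :
  limg f = lker g -> limg (ffun_map I f) = lker (ffun_map I g).
Proof.
move=> fg; apply/vspaceP => v; rewrite memv_ker.
apply/memv_imgP/eqP => [[u _ ->] | gv].
  apply/ffunP => i; rewrite !ffun_mapE ffunE; apply/eqP.
  by rewrite -memv_ker -fg memv_img ?memvf.
have vf i : v i \in limg f.
  by rewrite fg memv_ker -ffun_mapE gv ffunE.
exists [ffun i => (f^-1)%VF (v i)]; first exact: memvf.
by apply/ffunP => i; rewrite ffun_mapE ffunE limg_lfunVK.
Qed.

Lemma ffun_map_surj (K : fieldType) (I : finType) (U V : vectType K) (f : 'Hom(U, V)) :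
  limg f = fullv -> limg (ffun_map I f) = fullv.
Proof.
move=> ff; apply/vspaceP => v; rewrite memvf; apply/memv_imgP.
exists [ffun i => (f^-1)%VF (v i)]; first exact: memvf.
by apply/ffunP => i; rewrite ffun_mapE ffunE limg_lfunVK // ff memvf.
Qed.

Section HomogeneousComponents.
Variables (K : fieldType) (gT : finGroupType).

Lemma hcomp_homog (V : vectType K) (Vg : gT -> {vspace V}) g h v :
  is_grading Vg -> v \in Vg h -> hcomp Vg g v = v *+ (g == h).
Proof.
move=> grV vh; rewrite -{1}[v](_ : \sum_k (v *+ (k == h)) = v).
  rewrite hcomp_uniq // => k.
  by case: eqP => [->|_]; rewrite ?mulr1n ?mulr0n ?mem0v.
by rewrite (bigD1 h) //= eqxx big1 ?addr0 // => k /negPf->.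
Qed.

Lemma hcomp_deg0 (U V : vectType K) (Ug : gT -> {vspace U}) (Vg : gT -> {vspace V})
    (d : 'Hom(U, V)) g u :
  is_grading Ug -> is_grading Vg -> (forall h x, x \in Ug h -> d x \in Vg h) ->
  hcomp Vg g (d u) = d (hcomp Ug g u).
Proof.
move=> grU grV dU; rewrite -{1}(hcomp_sum u grU) linear_sum hcomp_uniq // => h.
exact/dU/hcomp_mem.
Qed.

(** The component of degree g of f: it maps degree u to degree u g. *)
Definition hom_component (U V : vectType K) (Ug : gT -> {vspace U}) (Vg : gT -> {vspace V})
    (g : gT) (f : 'Hom(U, V)) : 'Hom(U, V) :=
  \sum_u (hcomp Vg (u * g)%g \o (f \o hcomp Ug u))%VF.

Section HomComp.
Variables (U V : vectType K) (Ug : gT -> {vspace U}) (Vg : gT -> {vspace V}).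
Hypotheses (grU : is_grading Ug) (grV : is_grading Vg).

Lemma hom_componentE g (f : 'Hom(U, V)) x :
  hom_component Ug Vg g f x = \sum_u hcomp Vg (u * g)%g (f (hcomp Ug u x)).
Proof. by rewrite sum_lfunE; apply: eq_bigr => u _; rewrite !comp_lfunE. Qed.

Lemma hom_component_homog g (f : 'Hom(U, V)) h x :
  x \in Ug h -> hom_component Ug Vg g f x = hcomp Vg (h * g)%g (f x).
Proof.
move=> xh; rewrite hom_componentE (bigD1 h) //= big1 ?addr0 => [|u uh].
  by rewrite (hcomp_homog _ grU xh) eqxx.
by rewrite (hcomp_homog _ grU xh) (negPf uh) mulr0n !linear0.
Qed.

Lemma hom_component_deg g (f : 'Hom(U, V)) h x :
  x \in Ug h -> hom_component Ug Vg g f x \in Vg (h * g)%g.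
Proof. by move=> xh; rewrite (hom_component_homog _ _ xh) hcomp_mem. Qed.

Lemma eq_hom_homog (f f' : 'Hom(U, V)) :
  (forall h x, x \in Ug h -> f x = f' x) -> f = f'.
Proof.
move=> ff'; apply/lfunP => x; rewrite -(hcomp_sum x grU) !linear_sum.
by apply: eq_bigr => h _; apply/ff'/hcomp_mem.
Qed.

Lemma hom_component_sum (f : 'Hom(U, V)) : \sum_g hom_component Ug Vg g f = f.
Proof.
apply: eq_hom_homog => h x xh; rewrite sum_lfunE.
rewrite (eq_bigr (fun g => hcomp Vg (h * g)%g (f x))) => [|g _]; last first.
  exact: hom_component_homog.
by rewrite -[RHS](hcomp_sum _ grV) [RHS](reindex_inj (mulgI h)).
Qed.

Lemma hom_component_id g j (f : 'Hom(U, V)) :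
  (forall h x, x \in Ug h -> f x \in Vg (h * j)%g) ->
  hom_component Ug Vg g f = f *+ (g == j).
Proof.
move=> fj; apply: eq_hom_homog => h x xh; rewrite (hom_component_homog _ _ xh).
rewrite (hcomp_homog _ grV (fj _ _ xh)) (inj_eq (mulgI h)).
by case: eqP => _; rewrite ?mulr1n // !mulr0n zero_lfunE.
Qed.

End HomComp.

Lemma hom_component_precomp (U U' V : vectType K) (Ug : gT -> {vspace U})
    (Ug' : gT -> {vspace U'}) (Vg : gT -> {vspace V}) (d : 'Hom(U', U)) g
    (f : 'Hom(U, V)) :
  is_grading Ug -> is_grading Ug' -> (forall h x, x \in Ug' h -> d x \in Ug h) ->
  hom_component Ug' Vg g (f \o d)%VF = (hom_component Ug Vg g f \o d)%VF.
Proof.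
move=> grU grU' dU; apply: (eq_hom_homog grU') => h x xh.
rewrite comp_lfunE (hom_component_homog _ grU' _ _ xh).
by rewrite (hom_component_homog _ grU _ _ (dU _ _ xh)) comp_lfunE.
Qed.

End HomogeneousComponents.

(** * The adjunction between smash modules and restriction *)

Section Adjunction.
Variables (K : fieldType) (gT : finGroupType) (A : falgType K) (gA : galg gT A).
Local Notation S := (smash_alg gA).

Lemma smash_prM g k : smash_pure gA 1 g * smash_pure gA 1 k = smash_pure gA 1 k *+ (g == k).
Proof.
rewrite smash_pureM mul1r (hcomp_id _ (galg_one gA)) -eq_mulgV1.
by apply/ffunP => h; case: eqP => _; rewrite // !mulr0n !smash_pureE ffunE mul0rn.
Qed.

(** Homogeneous elements of A permute the idempotents 1 # p_k. *)
Lemma smash_pr_emb b s k : b \in gA s ->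
  smash_pure gA 1 k * smash_emb gA b = smash_emb gA b * smash_pure gA 1 (s^-1 * k)%g.
Proof.
move=> bs; rewrite -[LHS]mulr1 -(smash_pr_sum gA) mulr_sumr (bigD1 (s^-1 * k)%g) //=.
rewrite big1 ?addr0 => [|l lk]; rewrite -mulrA smash_pr_emb_pr (hcomp_id _ bs).
  by rewrite invMg invgK mulgA mulgV mul1g eqxx.
have /negPf-> : (k * l^-1)%g != s.
  by apply: contra lk => /eqP<-; rewrite invMg invgK mulgKV.
by rewrite mulr0n smash_emb_pure mul0r; apply/ffunP => h; rewrite smash_pureE mul0rn ffunE.
Qed.

Variable M : gmod gA.
Local Notation pr := (smash_pure gA 1).
Local Notation hc := (hcomp (gmod_deg M)).

Let grM : is_grading (gmod_deg M). Proof. by case: (gmod_graded M). Qed.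

Lemma smash_actE (x : S) (v : smash_mod M) h :
  (act x v : {ffun gT -> M}) h =
  \sum_g act (x g) (hc (g * h^-1)%g ((v : {ffun gT -> M}) h)).
Proof. by rewrite lfunE /= ffunE. Qed.

Lemma smash_act_emb a (v : smash_mod M) h :
  (act (smash_emb gA a) v : {ffun gT -> M}) h = act a ((v : {ffun gT -> M}) h).
Proof.
rewrite smash_actE; under eq_bigr => g _ do rewrite smash_embE.
rewrite -linear_sum; congr (act a _).
by rewrite -[RHS](hcomp_sum _ grM) [RHS](reindex_inj (mulIg (h^-1)%g)).
Qed.

Lemma smash_act_pr g (v : smash_mod M) h :
  (act (pr g) v : {ffun gT -> M}) h = hc (g * h^-1)%g ((v : {ffun gT -> M}) h).
Proof.
rewrite smash_actE (bigD1 g) //= big1 ?addr0 => [|k kg]; rewrite smash_pureE.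
  by rewrite eqxx act1.
by rewrite (negPf kg) act0 zero_lfunE.
Qed.

(** The unit of the adjunction: m |-> sum of the m (x) p_h. *)
Definition smash_unit : 'Hom(M, smash_mod M) := const_map gT M.

Lemma smash_unit_hom : is_hom (smash_unit : 'Hom(M, restr_mod (smash_mod M))).
Proof.
by move=> a m; apply/ffunP => h; rewrite const_mapE [RHS]smash_act_emb const_mapE.
Qed.

(** For m_u of degree u, the idempotent 1 # p_(u h) extracts m_u (x) p_h from the
    diagonal of m_u, since m_u (x) p_k has degree u k. *)
Lemma smash_decomp (v : smash_mod M) :
  v = \sum_h \sum_u act (pr (u * h)%g) (smash_unit (hc u ((v : {ffun gT -> M}) h))).
Proof.
apply/ffunP => k; rewrite sum_ffunE (bigD1 k) //= [X in _ + X]big1 ?addr0 => [|h hk].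
  rewrite sum_ffunE -[LHS](hcomp_sum _ grM); apply: eq_bigr => u _.
  by rewrite [RHS]smash_act_pr const_mapE (hcomp_homog _ grM (hcomp_mem _ _ _)) mulgK eqxx.
rewrite sum_ffunE big1 // => u _; rewrite [LHS]smash_act_pr const_mapE.
rewrite (hcomp_homog _ grM (hcomp_mem _ _ _)) -mulgA -[X in _ == X]mulg1 (inj_eq (mulgI u)).
by rewrite -eq_mulgV1 (negPf hk).
Qed.

Variable N : fmod S.

(** The only possible S-linear extension of f, as dictated by [smash_decomp]. *)
Definition smash_adjoint_fun (f : 'Hom(M, N)) (v : {ffun gT -> M}) : N :=
  \sum_h \sum_u act (pr (u * h)%g) (f (hc u (v h))).

Lemma smash_adjoint_fun_linear f : linear (smash_adjoint_fun f).
Proof.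
move=> k v w; rewrite /smash_adjoint_fun scaler_sumr -big_split; apply: eq_bigr => h _ /=.
rewrite scaler_sumr -big_split; apply: eq_bigr => u _.
by rewrite !ffunE !linearP.
Qed.

HB.instance Definition _ f :=
  GRing.isLinear.Build K {ffun gT -> M} N _ (smash_adjoint_fun f) (smash_adjoint_fun_linear f).

Definition smash_adjoint (f : 'Hom(M, N)) : 'Hom(smash_mod M, N) :=
  linfun (smash_adjoint_fun f).

Lemma smash_adjointE f v :
  smash_adjoint f v = \sum_h \sum_u act (pr (u * h)%g) (f (hc u ((v : {ffun gT -> M}) h))).
Proof. by rewrite lfunE. Qed.

Lemma smash_adjoint_unit f : (smash_adjoint f \o smash_unit)%VF = f.
Proof.
apply/lfunP => m; rewrite comp_lfunE smash_adjointE exchange_big /=.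
rewrite -[in RHS](hcomp_sum m grM) linear_sum; apply: eq_bigr => u _.
under eq_bigr => h _ do rewrite const_mapE.
rewrite -act_suml -[RHS]act1 -(smash_pr_sum gA).
by rewrite [in RHS](reindex_inj (mulgI u)).
Qed.

Lemma hom_unit_adjoint (F : 'Hom(smash_mod M, N)) :
  is_hom F -> smash_adjoint (F \o smash_unit)%VF = F.
Proof.
move=> hF; apply/lfunP => v; rewrite smash_adjointE [in RHS](smash_decomp v) linear_sum.
apply: eq_bigr => h _; rewrite linear_sum; apply: eq_bigr => u _.
by rewrite comp_lfunE; apply/esym/hF.
Qed.

Lemma eq_hom_unit (F F' : 'Hom(smash_mod M, N)) :
  is_hom F -> is_hom F' -> (F \o smash_unit)%VF = (F' \o smash_unit)%VF -> F = F'.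
Proof. by move=> hF hF' E; rewrite -(hom_unit_adjoint hF) E hom_unit_adjoint. Qed.

Lemma smash_adjoint_hom (f : 'Hom(M, restr_mod N)) : is_hom f -> is_hom (smash_adjoint f).
Proof.
move=> hf; have hemb a v : smash_adjoint f (act (smash_emb gA a) v) =
    act (smash_emb gA a) (smash_adjoint f v).
  rewrite !smash_adjointE linear_sum; apply: eq_bigr => h _; rewrite linear_sum /=.
  set m : M := (v : {ffun gT -> M}) h.
  transitivity (\sum_u \sum_t act (smash_emb gA (hcomp gA (u * t^-1)%g a))
                          (act (pr (t * h)%g) (f (hc t m)))).
    apply: eq_bigr => u _; rewrite smash_act_emb -/m.
    rewrite -{1}(hcomp_sum m grM) !linear_sum; apply: eq_bigr => t _ /=.
    rewrite (hcomp_act _ _ (gmod_graded M) (hcomp_mem _ _ _)) hf -!actM.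
    rewrite (smash_pr_emb _ (hcomp_mem _ _ _)).
    by rewrite invMg invgK mulgA mulgKV.
  rewrite exchange_big; apply: eq_bigr => t _ /=.
  rewrite -act_suml; congr (act _ _); apply/ffunP => k; rewrite sum_ffunE.
  under eq_bigr => u _ do rewrite smash_embE.
  rewrite smash_embE -[RHS](hcomp_sum a (galg_grading gA)).
  by rewrite [RHS](reindex_inj (mulIg t^-1%g)).
have hpr g v : smash_adjoint f (act (pr g) v) = act (pr g) (smash_adjoint f v).
  rewrite !smash_adjointE linear_sum; apply: eq_bigr => h _; rewrite linear_sum /=.
  apply: eq_bigr => u _; rewrite smash_act_pr -actM smash_prM.
  rewrite (hcomp_homog _ grM (hcomp_mem _ _ _)).
  have [->|gu] := eqVneq g (u * h)%g; first by rewrite mulgK eqxx.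
  rewrite mulr0n act0 zero_lfunE; case: eqP => [E|_]; last by rewrite mulr0n !linear0.
  by rewrite E mulgKV eqxx in gu.
have hpure b g v : smash_adjoint f (act (smash_pure gA b g) v) =
    act (smash_pure gA b g) (smash_adjoint f v).
  by rewrite -[b]mulr1 -smash_emb_pure !actM hemb hpr.
move=> x v; rewrite (smash_pure_sum x) !act_suml linear_sum.
by apply: eq_bigr => g _; apply: hpure.
Qed.

End Adjunction.

(** * Ext over the smash product *)

Section SmashFunctor.
Variables (K : fieldType) (gT : finGroupType) (A : falgType K) (gA : galg gT A).
Local Notation S := (smash_alg gA).

Lemma gmod_grading (M : gmod gA) : is_grading (gmod_deg M).
Proof. by case: (gmod_graded M). Qed.

Lemma smash_map_hom (M M' : gmod gA) (d : 'Hom(M, M')) :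
  is_hom d -> (forall g x, x \in gmod_deg M g -> d x \in gmod_deg M' g) ->
  is_hom (ffun_map gT d : 'Hom(smash_mod M, smash_mod M')).
Proof.
move=> hd dM x v; apply/ffunP => h; rewrite ffun_mapE [RHS]smash_actE.
rewrite smash_actE linear_sum; apply: eq_bigr => g _ /=.
by rewrite ffun_mapE hd (hcomp_deg0 _ _ (gmod_grading M) (gmod_grading M') dM).
Qed.

Lemma ffun_map_unit (M M' : gmod gA) (d : 'Hom(M, M')) :
  (ffun_map gT d \o smash_unit M)%VF = (smash_unit M' \o d)%VF.
Proof.
by apply/lfunP => m; apply/ffunP => h; rewrite !comp_lfunE ffun_mapE !const_mapE.
Qed.

(** A left adjoint of an exact functor preserves projectives. *)
Lemma smash_projective (M : gmod gA) : projective M -> projective (smash_mod M).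
Proof.
move=> prjM Y Z p f hp sp hf.
have hfu : is_hom (f \o smash_unit M : 'Hom(M, restr_mod Z))%VF.
  exact: (is_hom_comp (restr_hom hf) (@smash_unit_hom _ _ _ _ M)).
have [g hg pg] := prjM (restr_mod Y) (restr_mod Z) p _ (restr_hom hp) sp hfu.
exists (smash_adjoint g); first exact: smash_adjoint_hom.
apply: eq_hom_unit => //; first by apply: is_hom_comp => //; apply: smash_adjoint_hom.
by rewrite -comp_lfunA smash_adjoint_unit.
Qed.

Section Resolution.
Variables (X : gmod gA) (P : gresolution gA (gmod_deg X)).

Definition gres_mod n : gmod gA := Gmod (gres_graded P n).

Definition smash_res_d n : 'Hom(smash_mod (gres_mod n.+1), smash_mod (gres_mod n)) :=
  ffun_map gT (res_d P n).

Definition smash_res_aug : 'Hom(smash_mod (gres_mod 0), smash_mod X) :=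
  ffun_map gT (res_aug P).

Lemma smash_res_d_hom n : is_hom (smash_res_d n).
Proof. by apply: smash_map_hom; [apply: res_d_hom | apply: gres_d_deg]. Qed.

Lemma smash_res_aug_hom : is_hom smash_res_aug.
Proof. by apply: smash_map_hom; [apply: res_aug_hom | apply: gres_aug_deg]. Qed.

Definition smash_res : resolution (smash_mod X) :=
  @Resolution K S (smash_mod X) (fun n => smash_mod (gres_mod n))
    smash_res_d smash_res_aug
    (fun n => smash_projective (M := gres_mod n) (@res_projective _ _ _ P n))
    smash_res_d_hom smash_res_aug_hom
    (fun n => ffun_map_exact gT (res_exact P n))
    (ffun_map_exact gT (res_exact0 P)) (ffun_map_surj gT (res_aug_surj P)).

End Resolution.


Section Shapiro.
Variables (X : gmod gA) (P : gresolution gA (gmod_deg X)) (Y : gmod gA).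
Local Notation sP := (smash_res P).
Local Notation sY := (smash_mod Y).

(** The k-th of the maps P i -> Y that correspond to F by adjunction, the restriction
    of Y# to A being a sum of copies of Y indexed by G. *)
Definition hom_slice i (k : gT) (F : 'Hom(sP i, sY)) : 'Hom(P i, Y) :=
  (ffun_eval Y k \o F \o smash_unit (gres_mod P i))%VF.

Definition hom_glue i (f : gT -> 'Hom(P i, Y)) : 'Hom(sP i, sY) :=
  smash_adjoint (M := gres_mod P i) (bundle f : 'Hom(P i, sY)).

Lemma hom_sliceE i k (F : 'Hom(sP i, sY)) m :
  hom_slice k F m = (F (smash_unit (gres_mod P i) m) : {ffun gT -> Y}) k.
Proof. by rewrite !comp_lfunE ffun_evalE. Qed.

Lemma bundle_hom i (f : gT -> 'Hom(P i, Y)) :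
  (forall k, is_hom (f k)) -> is_hom (bundle f : 'Hom(P i, restr_mod sY)).
Proof.
move=> hf a m; apply/ffunP => k; rewrite bundleE [RHS]smash_act_emb bundleE.
exact: hf.
Qed.

Lemma hom_glue_hom i (f : gT -> 'Hom(P i, Y)) :
  (forall k, is_hom (f k)) -> is_hom (hom_glue f).
Proof. by move=> hf; apply: smash_adjoint_hom; apply: bundle_hom. Qed.

Lemma hom_glueK i (f : gT -> 'Hom(P i, Y)) k : hom_slice k (hom_glue f) = f k.
Proof.
apply/lfunP => m; rewrite hom_sliceE -comp_lfunE smash_adjoint_unit; exact: bundleE.
Qed.

Lemma hom_slice_hom i k (F : 'Hom(sP i, sY)) : is_hom F -> is_hom (hom_slice k F).
Proof.
move=> hF a m; rewrite !hom_sliceE.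
have -> : smash_unit (gres_mod P i) (act a m) =
    act (smash_emb gA a) (smash_unit (gres_mod P i) m) by apply: smash_unit_hom.
by rewrite hF smash_act_emb.
Qed.

Lemma eq_slice i (F F' : 'Hom(sP i, sY)) :
  is_hom F -> is_hom F' -> (forall k, hom_slice k F = hom_slice k F') -> F = F'.
Proof.
move=> hF hF' E; apply: (eq_hom_unit (M := gres_mod P i)) => //.
apply/lfunP => m; apply/ffunP => k; have /lfunP/(_ m) := E k.
by rewrite !hom_sliceE !comp_lfunE.
Qed.

Lemma hom_slice_d i k (F : 'Hom(sP i, sY)) :
  hom_slice k (F \o res_d sP i)%VF = (hom_slice k F \o res_d P i)%VF.
Proof.
rewrite /hom_slice -!comp_lfunA; congr (_ \o (_ \o _))%VF.
exact: (@ffun_map_unit (gres_mod P i.+1) (gres_mod P i)).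
Qed.

Lemma hom_slice0 i k : hom_slice k (0 : 'Hom(sP i, sY)) = 0.
Proof. by rewrite /hom_slice comp_lfun0r comp_lfun0l. Qed.

Lemma hom_sliceP i k c (F F' : 'Hom(sP i, sY)) :
  hom_slice k (c *: F + F') = c *: hom_slice k F + hom_slice k F'.
Proof. by rewrite /hom_slice comp_lfunDr comp_lfunDl -comp_lfunZr -comp_lfunZl. Qed.

Lemma slice_cocycleP i (F : 'Hom(sP i, sY)) : is_hom F ->
  F \in cocycles sP sY i <-> forall k, hom_slice k F \in cocycles P Y i.
Proof.
move=> hF; split=> [/cocyclesP[_ Fd] k | FZ].
  apply/cocyclesP; split; first exact: hom_slice_hom.
  by rewrite -hom_slice_d Fd hom_slice0.
apply/cocyclesP; split=> //; apply: eq_slice => [||k].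
- by apply: is_hom_comp => //; apply: res_d_hom.
- exact: is_hom0.
by rewrite hom_slice_d hom_slice0; case/cocyclesP: (FZ k).
Qed.

Lemma slice_coboundaryP i (F : 'Hom(sP i, sY)) : is_hom F ->
  F \in coboundaries sP sY i <-> forall k, hom_slice k F \in coboundaries P Y i.
Proof.
case: i F => [|i] F hF.
  rewrite memv0; split=> [/eqP-> k|F0]; first by rewrite hom_slice0 mem0v.
  apply/eqP; apply: eq_slice => // [|k]; first exact: is_hom0.
  by have := F0 k; rewrite memv0 hom_slice0 => /eqP.
split=> [/coboundariesP[T hT ->] k | FB].
  by apply/coboundariesP; exists (hom_slice k T); [apply: hom_slice_hom | apply: hom_slice_d].
have tP k : exists t : 'Hom(P i, Y), is_hom t /\ hom_slice k F = (t \o res_d P i)%VF.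
  by have /coboundariesP[t ht tE] := FB k; exists t.
pose t k := sval (constructive_indefinite_description _ (tP k)).
have tE k : is_hom (t k) /\ hom_slice k F = (t k \o res_d P i)%VF.
  by rewrite /t; case: constructive_indefinite_description.
have ht k : is_hom (t k) by case: (tE k).
apply/coboundariesP; exists (hom_glue t); first exact: hom_glue_hom.
apply: eq_slice => // [|k].
  by apply: is_hom_comp; [apply: hom_glue_hom | apply: res_d_hom].
by rewrite hom_slice_d hom_glueK; case: (tE k).
Qed.

Definition ext_slice_fun i (x : Ext sP sY i) : {ffun gT -> Ext P Y i} :=
  [ffun k => ext_class (hom_slice k (ext_repr x))].

Lemma ext_slice_linear i : linear (@ext_slice_fun i).
Proof.
move=> c x y; apply/ffunP => k; rewrite !ffunE /ext_repr linearP hom_sliceP.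
by rewrite /ext_class linearP.
Qed.

HB.instance Definition _ i :=
  GRing.isLinear.Build K (Ext sP sY i) {ffun gT -> Ext P Y i} _ (@ext_slice_fun i)
    (@ext_slice_linear i).

Definition ext_slice i : 'Hom(Ext sP sY i, {ffun gT -> Ext P Y i}) :=
  linfun (@ext_slice_fun i).

Lemma ext_sliceE i F k : F \in cocycles sP sY i ->
  (ext_slice i (ext_class F) : {ffun gT -> Ext P Y i}) k = ext_class (hom_slice k F).
Proof.
move=> FZ; have /cocyclesP[hF _] := FZ.
have F'Z := ext_repr_cocycle (ext_class F : Ext sP sY i).
have /cocyclesP[hF' _] := F'Z.
rewrite lfunE /= ffunE; apply: ext_class_eq.
- by move: k; apply/slice_cocycleP.
- by move: k; apply/slice_cocycleP.
have := ext_repr_class FZ; move/slice_coboundaryP => /(_ (is_homB hF' hF) k).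
by rewrite addrC -scaleN1r hom_sliceP scaleN1r addrC.
Qed.

Lemma ext_slice_bijective i : bijective (ext_slice i).
Proof.
apply: lfun_bijective => [x x0 | x].
  rewrite -[x]ext_reprK; have FZ := ext_repr_cocycle x.
  apply/eqP; rewrite ext_class_eq0 //; have /cocyclesP[hF _] := FZ.
  apply/slice_coboundaryP => // k.
  rewrite -ext_class_eq0; last by move: k; apply/slice_cocycleP.
  by rewrite -ext_sliceE // ext_reprK x0 ffunE.
pose f k := ext_repr ((x : {ffun gT -> Ext P Y i}) k).
have fZ k : f k \in cocycles P Y i by apply: ext_repr_cocycle.
have hf k : is_hom (f k) by case/cocyclesP: (fZ k).
exists (ext_class (hom_glue f)); apply/ffunP => k; rewrite ext_sliceE.
  by rewrite hom_glueK ext_reprK.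
by apply/slice_cocycleP => [|k']; [apply: hom_glue_hom | rewrite hom_glueK].
Qed.

(** F maps m (x) p_h to the sum of the (f_k)_(h k^-1)(m) (x) p_k, where f_k is
    the k-th slice of F. *)
Lemma hom_glueE i (F : 'Hom(sP i, sY)) v k : is_hom F ->
  (F v : {ffun gT -> Y}) k =
  \sum_h hom_component (gres_deg P i) (gmod_deg Y) (h * k^-1)%g (hom_slice k F)
           ((v : {ffun gT -> P i}) h).
Proof.
move=> hF; rewrite -[in LHS](hom_unit_adjoint (M := gres_mod P i) hF) smash_adjointE sum_ffunE.
apply: eq_bigr => h _; rewrite hom_componentE sum_ffunE; apply: eq_bigr => u _.
by rewrite [LHS]smash_act_pr comp_lfunE hom_sliceE mulgA.
Qed.

(** The component f_g is the restriction to P i (x) p_g, followed by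
    evaluation at 1, of the S-linear map all of whose slices are f. *)
Lemma hom_component_hom i g (f : 'Hom(P i, Y)) :
  is_hom f -> is_hom (hom_component (gres_deg P i) (gmod_deg Y) g f).
Proof.
move=> hf; pose F := hom_glue (fun _ => f).
have hF : is_hom F by apply: hom_glue_hom.
have E m : hom_component (gres_deg P i) (gmod_deg Y) g f m =
    (F (pure_tensor m g : sP i) : {ffun gT -> Y}) 1%g.
  rewrite hom_glueE // (bigD1 g) //= big1 ?addr0 => [|h hg]; rewrite ffunE.
    by rewrite eqxx hom_glueK invg1 mulg1.
  by rewrite (negPf hg) mulr0n linear0.
move=> a m; rewrite !E.
have -> : pure_tensor (act a m) g =
    act (smash_emb gA a) (pure_tensor m g : smash_mod (gres_mod P i)).
  by apply/ffunP => k; rewrite [RHS]smash_act_emb !ffunE raddfMn.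
by rewrite hF smash_act_emb.
Qed.

End Shapiro.

End SmashFunctor.

(** * The grading of Ext and the products over the smash product *)

Section ExtGradingTheory.
Variables (K : fieldType) (gT : finGroupType) (A : falgType K) (gA : galg gT A).

Section Grading.
Variables (X : gmod gA) (P : gresolution gA (gmod_deg X)) (Y : gmod gA).
Local Notation hc i := (hom_component (gres_deg P i) (gmod_deg Y)).

Lemma gres_grading i : is_grading (gres_deg P i).
Proof. by case: (gres_graded P i). Qed.

Lemma hom_component0 i g : hc i g 0 = 0.
Proof.
by rewrite /hom_component big1 // => u _; rewrite comp_lfun0l comp_lfun0r.
Qed.

Lemma hom_componentB i g f f' : hc i g (f - f') = hc i g f - hc i g f'.
Proof.
rewrite /hom_component -sumrB; apply: eq_bigr => u _.
by rewrite comp_lfunDl comp_lfunNl comp_lfunDr comp_lfunNr.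
Qed.

Lemma hom_component_d i g (f : 'Hom(P i, Y)) :
  hc i.+1 g (f \o res_d P i)%VF = (hc i g f \o res_d P i)%VF.
Proof.
apply: hom_component_precomp; [exact: gres_grading | exact: gres_grading |].
exact: gres_d_deg.
Qed.

Lemma hom_component_cocycle i g f : f \in cocycles P Y i -> hc i g f \in cocycles P Y i.
Proof.
case/cocyclesP=> hf fd; apply/cocyclesP; split; first exact: hom_component_hom.
by rewrite -hom_component_d fd hom_component0.
Qed.

Lemma hom_component_coboundary i g f :
  f \in coboundaries P Y i -> hc i g f \in coboundaries P Y i.
Proof.
case: i f => [|i] f; first by rewrite !memv0 => /eqP->; rewrite hom_component0.
case/coboundariesP=> t ht ->; apply/coboundariesP; exists (hc i g t).
  exact: hom_component_hom.
exact: hom_component_d.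
Qed.

Definition ext_component i g (x : Ext P Y i) : Ext P Y i := ext_class (hc i g (ext_repr x)).

Lemma ext_component_class i g f :
  f \in cocycles P Y i -> @ext_component i g (ext_class f) = ext_class (hc i g f).
Proof.
move=> fZ; apply: ext_class_eq.
- exact/hom_component_cocycle/ext_repr_cocycle.
- exact: hom_component_cocycle.
by rewrite -hom_componentB; apply/hom_component_coboundary/ext_repr_class.
Qed.

Lemma ext_component_mem i g x : @ext_component i g x \in ext_deg P (gmod_deg Y) i g.
Proof.
apply: memv_img; rewrite memv_cap hom_component_cocycle ?ext_repr_cocycle //=.
by apply/hom_degP => h m mh; apply: hom_component_deg => //; apply: gres_grading.
Qed.

Lemma ext_component_sum i x : \sum_g @ext_component i g x = x.
Proof.
rewrite /ext_component /ext_class -linear_sum.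
by rewrite hom_component_sum; [apply: quotv_reprK | apply: gres_grading | apply: gmod_grading].
Qed.

Lemma ext_grading i : is_grading (ext_deg P (gmod_deg Y) i).
Proof.
apply: (is_grading_proj (pr := @ext_component i)) => [g x|x|g u uE].
- exact: ext_component_mem.
- exact: ext_component_sum.
have compB : additive (@ext_component i g).
  move=> x y; rewrite /ext_component /ext_repr linearB hom_componentB.
  by rewrite /ext_class linearB.
pose c := HB.pack_for {additive Ext P Y i -> Ext P Y i} (@ext_component i g)
  (GRing.isZmodMorphism.Build _ _ _ compB).
have -> : ext_component g (\sum_j u j) = \sum_j ext_component g (u j) by apply: (raddf_sum c).
rewrite (bigD1 g) //= big1 ?addr0 => [|h hg].
  case/memv_imgP: (uE g) => f; rewrite memv_cap => /andP[fZ /hom_degP fg] ->.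
  rewrite -[quotv_pi _ _ _]/(ext_class _) ext_component_class //.
  by rewrite (hom_component_id (gres_grading i) (gmod_grading Y) g fg) eqxx.
case/memv_imgP: (uE h) => f; rewrite memv_cap => /andP[fZ /hom_degP fh] ->.
rewrite -[quotv_pi _ _ _]/(ext_class _) ext_component_class //.
rewrite (hom_component_id (gres_grading i) (gmod_grading Y) g fh).
by rewrite eq_sym (negPf hg) mulr0n /ext_class linear0.
Qed.

Lemma hcomp_ext i g f : f \in cocycles P Y i ->
  hcomp (ext_deg P (gmod_deg Y) i) g (ext_class f) = ext_class (hc i g f).
Proof.
move=> fZ; rewrite -[in LHS](ext_component_sum (ext_class f)).
rewrite hcomp_uniq; [exact: ext_component_class | exact: ext_grading |].
by move=> h; apply: ext_component_mem.
Qed.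

End Grading.

Section Product.
Variables (X Y Z : gmod gA).
Variables (P : gresolution gA (gmod_deg X)) (Q : gresolution gA (gmod_deg Y)).

Lemma hom_slice_map (V W : gmod gA) (d : 'Hom(V, W)) i k
    (F : 'Hom(smash_res P i, smash_mod V)) :
  hom_slice (Y := W) k (ffun_map gT d \o F)%VF = (d \o hom_slice (Y := V) k F)%VF.
Proof.
by apply/lfunP => m; rewrite hom_sliceE !comp_lfunE ffun_mapE ffun_evalE.
Qed.

(** Glue lifts L g of the slices of a representative F of x into a lift Psi of F.
    By [hom_glueE], the slice at h of a representative H of y composed with
    Psi is the sum over g of the component of degree g h^-1 of the slice of H
    at h, composed with L g. *)
Lemma ext_slice_yoneda r l (x : Ext (smash_res P) (smash_mod Y) r)
    (y : Ext (smash_res Q) (smash_mod Z) l) h :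
  (ext_slice P Z (l + r) (yoneda x y) : {ffun gT -> Ext P Z (l + r)%N}) h =
  \sum_g yoneda ((ext_slice P Y r x : {ffun gT -> Ext P Y r}) g)
    (hcomp (ext_deg Q (gmod_deg Z) l) (g * h^-1)%g
       ((ext_slice Q Z l y : {ffun gT -> Ext Q Z l}) h)).
Proof.
rewrite -[x]ext_reprK -[y]ext_reprK.
have FZ := ext_repr_cocycle x; set F := ext_repr x in FZ *.
have HZ := ext_repr_cocycle y; set H := ext_repr y in HZ *.
have /cocyclesP[hF _] := FZ; have /cocyclesP[hH _] := HZ.
have fZ g : hom_slice g F \in cocycles P Y r by move: g; apply/slice_cocycleP.
have zZ : hom_slice h H \in cocycles Q Z l by move: h; apply/slice_cocycleP.
pose L g := lift Q (hom_slice g F).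
have liftL g : is_lift (hom_slice g F) (L g) by apply: lift_spec.
have hL n g : is_hom (L g n) by case: (liftL g).
pose Psi n := hom_glue (P := P) (Y := gres_mod Q n) (i := (n + r)%N) (fun g => L g n).
have hPsi n : is_hom (Psi n) by apply: hom_glue_hom.
have liftPsi : is_lift (P := smash_res P) (Q := smash_res Q) F Psi.
  split=> [//||n].
    apply: eq_slice => // [|k].
      by apply: is_hom_comp => //; apply: res_aug_hom.
    rewrite (@hom_slice_map (gres_mod Q 0) Y (res_aug Q)) hom_glueK.
    by case: (liftL k).
  apply: (eq_slice (Y := gres_mod Q n)) => [||k].
  - by apply: is_hom_comp => //; apply: res_d_hom.
  - by apply: is_hom_comp => //; apply: res_d_hom.
  rewrite (@hom_slice_map (gres_mod Q n.+1) (gres_mod Q n) (res_d Q n)).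
  rewrite hom_slice_d !hom_glueK.
  by case: (liftL k).
rewrite (yonedaE FZ HZ liftPsi) ext_sliceE; last exact: (lift_cocycle liftPsi).
have -> : hom_slice h (H \o Psi l)%VF = \sum_g (hom_component (gres_deg Q l) (gmod_deg Z)
    (g * h^-1)%g (hom_slice h H) \o L g l)%VF.
  apply/lfunP => m; rewrite hom_sliceE comp_lfunE hom_glueE // sum_lfunE.
  apply: eq_bigr => g _; rewrite comp_lfunE; congr (hom_component _ _ _ _ _).
  by rewrite -(hom_sliceE (Y := gres_mod Q l) g (Psi l)) hom_glueK.
rewrite /ext_class linear_sum; apply: eq_bigr => g _.
rewrite !ext_sliceE // hcomp_ext //.
by rewrite (yonedaE (fZ g) (hom_component_cocycle _ zZ) (liftL g)).
Qed.

End Product.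

Lemma ext_alg_smash_res (X : gmod gA) (P : gresolution gA (gmod_deg X)) :
  posgr_iso (ext_alg (smash_res P))
            (posgr_smash (E := ext_alg P) (ext_deg P (gmod_deg X))).
Proof.
exists (fun i => ext_slice P X i : 'Hom(ext_alg (smash_res P) i,
  posgr_smash (E := ext_alg P) (ext_deg P (gmod_deg X)) i)).
split=> [i||i j x y].
- exact: ext_slice_bijective.
- apply/ffunP => k; rewrite [LHS]ext_sliceE ?res_aug_cocycle // ffunE.
  congr ext_class; apply/lfunP => m.
  by rewrite hom_sliceE ffun_mapE const_mapE.
- by apply/ffunP => h; rewrite [RHS]ffunE; apply: ext_slice_yoneda.
Qed.

End ExtGradingTheory.

Section SmashProducts.
Variables (K : fieldType) (gT : finGroupType) (E1 E2 E3 : vectType K).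
Variables (gE2 : gT -> {vspace E2}) (m : E1 -> E2 -> E3).
Hypothesis grE2 : is_grading gE2.
Hypothesis m0l : forall y, m 0 y = 0.
Hypothesis mDr : forall x y y', m x (y + y') = m x y + m x y'.

Definition smash_prod (x : {ffun gT -> E1}) (y : {ffun gT -> E2}) : {ffun gT -> E3} :=
  [ffun h => \sum_g m (x g) (hcomp gE2 (g * h^-1)%g (y h))].

(** For y_u homogeneous of degree u, the element m x y_u placed in position h is
    the product of x placed in position u h and of y_u placed in position h. *)
Lemma prod_span_smash (U : {vspace E1}) (U' : {vspace {ffun gT -> E1}}) z :
  (forall x, x \in U' <-> forall g, x g \in U) ->
  z \in prod_span smash_prod U' fullv <-> forall h, z h \in prod_span m U fullv.
Proof.
have mr0 x : m x 0 = 0 by apply: (addrI (m x 0)); rewrite -mDr !addr0.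
have m_sum x (u : gT -> E2) : m x (\sum_g u g) = \sum_g m x (u g).
  exact: (big_morph _ (mDr x) (mr0 x)).
move=> U'P; split=> [zS h | zS].
  apply/prod_spanP => T mT; rewrite -ffun_evalE memv_preim.
  move/prod_spanP: zS; apply=> x y xU _; rewrite -memv_preim ffun_evalE ffunE.
  by apply: memv_suml => g _; apply: mT; [move: g; apply/U'P | apply: memvf].
apply/prod_spanP => T mT.
have pureT h : pure_tensor (z h) h \in T.
  pose inj : 'Hom(E3, {ffun gT -> E3}) := bundle (fun k => (\1%VF *+ (k == h))).
  have injE w : inj w = pure_tensor w h.
    apply/ffunP => k; rewrite bundleE ffunE.
    by case: eqP => _; rewrite ?mulr1n ?id_lfunE // !mulr0n zero_lfunE.
  rewrite -injE memv_preim; move/prod_spanP: (zS h); apply=> x y xU _.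
  rewrite -memv_preim -(hcomp_sum y grE2) m_sum linear_sum; apply: memv_suml => u _ /=.
  set yu := hcomp gE2 u y.
  have -> : inj (m x yu) = smash_prod (pure_tensor x (u * h)%g) (pure_tensor yu h).
    apply/ffunP => k; rewrite injE !ffunE.
    have [->|kh] := eqVneq k h; last first.
      by rewrite mulr0n big1 // => g _; rewrite linear0 mr0.
    rewrite (bigD1 (u * h)%g) //= big1 ?addr0 => [|g gu]; rewrite !ffunE.
      by rewrite eqxx !mulr1n mulgK (hcomp_homog _ grE2 (hcomp_mem _ _ _)) eqxx.
    by rewrite (negPf gu) mulr0n m0l.
  apply: mT; last exact: memvf.
  by apply/U'P => g; rewrite ffunE; case: eqP => _; rewrite ?mem0v.
have -> : z = \sum_h pure_tensor (z h) h.
  apply/ffunP => k; rewrite sum_ffunE (bigD1 k) //= ffunE eqxx big1 ?addr0 // => h hk.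
  by rewrite ffunE eq_sym (negPf hk).
by apply: memv_suml => h _.
Qed.

End SmashProducts.

(** * Quasi-Koszul modules and algebras *)

Lemma prod_span_full_iso (K : fieldType) (E1 E2 E3 F1 F2 F3 : vectType K)
    (m : E1 -> E2 -> E3) (n : F1 -> F2 -> F3)
    (f1 : 'Hom(E1, F1)) (f2 : 'Hom(E2, F2)) (f3 : 'Hom(E3, F3)) :
  bijective f1 -> bijective f2 -> bijective f3 ->
  (forall x y, f3 (m x y) = n (f1 x) (f2 y)) ->
  prod_span m fullv fullv = fullv <-> prod_span n fullv fullv = fullv.
Proof.
move=> [g1 _ K1] [g2 _ K2] [g3 f3K K3] fm; split=> full; apply/vspaceP => z; rewrite memvf.
  rewrite -(K3 z); apply: (prod_span_morph (U := fullv) (W := fullv) fm) => [*|*|].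
  - exact: memvf.
  - exact: memvf.
  - by rewrite full memvf.
apply/prod_spanP => T mT.
have : f3 z \in (f3 @: T)%VS.
  have : f3 z \in prod_span n fullv fullv by rewrite full memvf.
  move/prod_spanP; apply=> x y _ _.
  by rewrite -(K1 x) -(K2 y) -fm memv_img // mT ?memvf.
by case/memv_imgP=> t tT /(can_inj f3K)->.
Qed.

Section YonedaAdditive.
Variables (K : fieldType) (B : falgType K) (X Y Z : fmod B).
Variables (P : resolution X) (Q : resolution Y).

Lemma yoneda0l r l (y : Ext Q Z l) : yoneda (0 : Ext P Y r) y = 0.
Proof.
rewrite -[y]ext_reprK -[X in yoneda X _](linear0 (quotv_pi _ _)).
rewrite (@yonedaE _ _ _ _ _ Q r 0 (fun n => 0)) ?mem0v ?ext_repr_cocycle //.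
  by rewrite comp_lfun0r /ext_class linear0.
by split=> [n||n]; [apply: is_hom0 | rewrite comp_lfun0r | rewrite comp_lfun0r comp_lfun0l].
Qed.

Lemma yonedaDr r l (x : Ext P Y r) (y y' : Ext Q Z l) :
  yoneda x (y + y') = yoneda x y + yoneda x y'.
Proof. by rewrite /yoneda /ext_repr linearD comp_lfunDl /ext_class linearD. Qed.

End YonedaAdditive.

Lemma pointwise_fullv (K : fieldType) (I : finType) (i0 : I) (E : vectType K)
    (U : {vspace E}) (U' : {vspace {ffun I -> E}}) :
  (forall z, z \in U' <-> forall i, z i \in U) -> U' = fullv <-> U = fullv.
Proof.
move=> U'P; split=> full; apply/vspaceP => z; rewrite memvf.
  have : [ffun=> z] \in U' by rewrite full memvf.
  by move/U'P/(_ i0); rewrite ffunE.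
by apply/U'P => i; rewrite full memvf.
Qed.

Section SmashKoszul.
Variables (K : fieldType) (gT : finGroupType) (A : falgType K) (gA : galg gT A).

Lemma generated01_smash (X : gmod gA) (P : gresolution gA (gmod_deg X)) :
  generated01 (posgr_smash (E := ext_alg P) (ext_deg P (gmod_deg X))) <->
  generated01 (ext_alg P).
Proof.
set sE := posgr_smash _.
have powP i (z : sE i.+1) : z \in deg1_pow sE i <->
    forall g, (z : {ffun gT -> Ext P X i.+1}) g \in deg1_pow (ext_alg P) i.
  elim: i z => [|i IHi] z; first by split=> *; apply: memvf.
  apply: (@prod_span_smash _ _ _ _ _ _ (@posgr_mul _ (ext_alg P) i.+1 1)) => //.
  - exact: ext_grading.
  - by move=> y; apply: yoneda0l.
  - by move=> x y y'; apply: yonedaDr.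
have fullP i := pointwise_fullv 1%g (powP i.+1).
by split=> gen i; apply: (proj1 (fullP i)) || apply: (proj2 (fullP i)); apply: gen.
Qed.

Lemma ext1_generated_smash (X Y : gmod gA) (P : gresolution gA (gmod_deg X))
    (Q : gresolution gA (gmod_deg Y)) :
  ext1_generated (smash_res P) (smash_res Q) <-> ext1_generated P Q.
Proof.
have eqv i : prod_span (fun (x : Ext (smash_res P) (smash_mod Y) i)
      (y : Ext (smash_res Q) (smash_mod Y) 1) =>
      yoneda x y : Ext (smash_res P) (smash_mod Y) i.+1) fullv fullv = fullv <->
    prod_span (fun (x : Ext P Y i) (y : Ext Q Y 1) =>
      yoneda x y : Ext P Y i.+1) fullv fullv = fullv.
  pose m := fun (x : Ext P Y i) (y : Ext Q Y 1) => yoneda x y : Ext P Y i.+1.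
  have sm : prod_span (smash_prod (ext_deg Q (gmod_deg Y) 1) m) fullv fullv = fullv <->
      prod_span m fullv fullv = fullv.
    apply: (pointwise_fullv 1%g) => z; apply: prod_span_smash.
    - exact: ext_grading.
    - by move=> y; apply: (@yoneda0l _ _ _ _ _ P Q i 1).
    - by move=> x y y'; apply: (@yonedaDr _ _ _ _ _ P Q i 1).
    - by move=> x; split=> *; apply: memvf.
  apply: iff_trans sm.
  apply: (prod_span_full_iso (ext_slice_bijective P Y i) (ext_slice_bijective Q Y 1)
    (ext_slice_bijective P Y i.+1)) => x y.
  by apply/ffunP => h; rewrite ffunE; apply: (ext_slice_yoneda x y h).
by split=> gen i; [apply: (proj1 (eqv i)) | apply: (proj2 (eqv i))]; apply: gen.
Qed.

Hypothesis card_neq0 : (#|{: gT}|%:R != 0 :> K).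
Local Notation S := (smash_alg gA).
Local Notation T := (top_gmod gA card_neq0).

Definition top_to_smash : 'Hom(top_mod S, smash_mod T) :=
  (ffun_map gT (quotv_pi fullv (jacobson A)) \o quotv_repr fullv (jacobson S))%VF.

Definition smash_to_top : 'Hom(smash_mod T, top_mod S) :=
  (quotv_pi fullv (jacobson S) \o ffun_map gT (quotv_repr fullv (jacobson A)))%VF.

Lemma top_to_smashE (x : S) h :
  (top_to_smash (quotv_pi fullv (jacobson S) x) : {ffun gT -> top_mod A}) h =
  quotv_pi fullv (jacobson A) (x h).
Proof.
rewrite comp_lfunE ffun_mapE; apply: (@quot_piE _ _ (regular_mod A)).
have := @quot_repr_pi _ _ (regular_mod S) (jacobson S) x.
by move/(jacobson_smash card_neq0)/(_ h); rewrite !ffunE.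
Qed.

(** Both sides are S modulo the functions with values in J(A), by
    [jacobson_smash]. *)
Lemma top_smash : inverse_homs top_to_smash smash_to_top.
Proof.
have hom : is_hom top_to_smash.
  move=> s x; rewrite -(quotv_reprK x); set y := quotv_repr _ _ x.
  rewrite (quot_act_pi (@jacobson_submodule _ S)).
  have -> : act s (y : regular_mod S) = s * y by rewrite lfunE.
  apply/ffunP => h; rewrite top_to_smashE [RHS](smash_actE (M := T)) smash_mulE.
  rewrite linear_sum; apply: eq_bigr => g _ /=.
  rewrite top_to_smashE top_hcomp; last exact: top_graded.
  rewrite (quot_act_pi (@jacobson_submodule _ A)); congr (quotv_pi _ _ _).
  by rewrite lfunE.
have ba : (smash_to_top \o top_to_smash)%VF = \1%VF.
  apply/lfunP => x; rewrite -(quotv_reprK x) id_lfunE; set y := quotv_repr _ _ x.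
  rewrite comp_lfunE [smash_to_top _]comp_lfunE.
  apply: (@quot_piE _ _ (regular_mod S)); apply/(jacobson_smash card_neq0) => h.
  rewrite !ffunE ffun_mapE top_to_smashE.
  exact: (@quot_repr_pi _ _ (regular_mod A)).
have ab : (top_to_smash \o smash_to_top)%VF = \1%VF.
  apply/lfunP => v; rewrite id_lfunE comp_lfunE [smash_to_top _]comp_lfunE.
  by apply/ffunP => h; rewrite top_to_smashE ffun_mapE quotv_reprK.
split=> // s v; apply: (can_inj (g := smash_to_top) (f := top_to_smash)).
  by move=> x; rewrite -comp_lfunE ba id_lfunE.
by rewrite hom -!(comp_lfunE top_to_smash) ab !id_lfunE.
Qed.

End SmashKoszul.

Theorem theorem3 (K : fieldType) (gT : finGroupType) (A : falgType K)
    (gA : galg gT A) (M : gmod gA)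
    (char_ndvd : forall p : nat, p \in [pchar K] -> ~~ (p %| #|{: gT}|)%N) :
  [/\ quasi_koszul_mod (smash_mod M) <-> quasi_koszul_mod M,
      quasi_koszul_alg (smash_alg gA) <-> quasi_koszul_alg A &
      forall (P : gresolution gA (top_deg gA))
             (Q : resolution (top_mod (smash_alg gA))),
        posgr_iso (ext_alg Q)
                  (posgr_smash (E := ext_alg P) (ext_deg P (top_deg gA)))].
Proof.
have card_neq0 : #|{: gT}|%:R != 0 :> K.
  apply/negP => card0.
  have [|p pK] := natf0_pchar _ card0; first by apply/card_gt0P; exists 1%g.
  by have := char_ndvd p pK; rewrite (dvdn_pcharf pK) card0.
pose T := top_gmod gA card_neq0.
have top_iso := top_smash gA card_neq0.
have [PM] := gresolution_exists M; have [PT] := gresolution_exists T.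
have ext_iso (P : gresolution gA (top_deg gA)) (Q : resolution (top_mod (smash_alg gA))) :
    posgr_iso (ext_alg Q) (posgr_smash (E := ext_alg P) (ext_deg P (top_deg gA))).
  apply: posgr_iso_trans (ext_alg_smash_res (X := T) P).
  exact: ext_alg_iso top_iso.
split=> //.
  apply: iff_trans (quasi_koszul_modE (smash_res PM) (smash_res PT) top_iso) _.
  apply: iff_trans (ext1_generated_smash PM PT) _; apply: iff_sym.
  exact: quasi_koszul_modE (inverse_homs_id _).
have qkA : quasi_koszul_alg A <-> generated01 (ext_alg PT).
  split=> [qk | gen P]; first exact: qk.
  by apply: generated01_iso gen; apply: ext_alg_iso (inverse_homs_id _).
apply: iff_trans (iff_sym qkA); apply: iff_trans (generated01_smash (X := T) PT).
split=> [qk | gen Q].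
  have [Q] := resolution_exists (top_mod (smash_alg gA)).
  exact: generated01_iso (ext_iso PT Q) (qk Q).
exact: generated01_iso (posgr_iso_sym (ext_iso PT Q)) gen.
Qed.
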